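(* Let $\{A_n\}_{n=1}^\infty$ be pairwise disjoint measurable subsets of $(0,\infty)$ of positive measure with $m(A_n)\le1$, $m(A_n)\to0$ and $\sum_{n=1}^\infty m(A_n)=\infty$. Let $S_i^l\subseteq\mathbb{N}$ ($i,l\in\mathbb{N}$) be pairwise disjoint sets with $\sum_{n\in S_i^l}m(A_n)=1/l$, and put $B_i^l:=\bigcup_{n\in S_i^l}A_n$. Let $E$ be an r.i. space on $[0,1]$ such that there exists an isomorphic embedding $T\colon\mathcal{U}_E\to E$, where $\mathcal{U}_E$ is the closed linear span of $\{\chi_{A_n}\}_{n=1}^\infty$ in $Z_E$. Suppose that there is an infinite sequence $\{l_k\}_{k=1}^\infty\subset\mathbb{N}$ such that the functions $y_i^{l_k}:=T(\chi_{B_i^{l_k}})$, $k,i\in\mathbb{N}$, are independent symmetrically distributed random variables and such that, for some $\alpha,\beta,\gamma>0$ and some sets $F_k\subset\mathbb{N}$, $k=1,2,\dots$, with $\gamma l_k\le\operatorname{card}F_k\le l_k$, $$m\big(\{t:|y_i^{l_k}(t)|>\alpha\}\big)\ge\frac{\beta}{l_k}\qquad\text{for each } i\in F_k,\ k=1,2,\dots$$ Then the Kruglov operator $K$ is bounded from $E$ into $E''$. Moreover, there is a constant $C>0$ such that $$\varphi_E\bigg(\Big(\frac{\beta}{2l_k}\Big)^{\gamma l_k}\bigg)\le\frac{C}{l_k},\qquad k=1,2,\dots,$$ where $\varphi_E$ is the fundamental function of $E$.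
   Context: $m$ is Lebesgue measure and $I=[0,1]$ or $(0,\infty)$. Functions $x,y$ are equimeasurable if $m\{|x|>\tau\}=m\{|y|>\tau\}$ for all $\tau>0$. An r.i. (rearrangement invariant) space $E$ on $I$ is a nonzero Banach space of (classes of) measurable functions on $I$ such that: if $|x|\le|y|$ a.e. and $y\in E$, then $x\in E$ and $\|x\|_E\le\|y\|_E$; and if $x,y$ are equimeasurable and $y\in E$, then $x\in E$ and $\|x\|_E=\|y\|_E$. For $I=[0,1]$ it is assumed that $\|\chi_{[0,1]}\|_E=1$. $x^*$ is the non-increasing rearrangement of $|x|$. The fundamental function of $E$ is $\varphi_E(t)=\|\chi_{[0,t]}\|_E$. $Z_E$ is the r.i. space on $(0,\infty)$ of all measurable $f$ with $\|f\|_{Z_E}:=\|f^*\chi_{[0,1]}\|_E+\|f^*\chi_{[1,\infty)}\|_{L^2}<\infty$ (a quasinorm equivalent to a norm). Up to isomorphism $\mathcal{U}_E$ does not depend on the choice of $\{A_n\}$ with the stated properties. The Köthe dual $E'$ consists of all measurable $y$ with $\|y\|_{E'}:=\sup\{\int_I|xy|\,dt:\|x\|_E\le 1\}<\infty$; $E''=(E')'$. The Kruglov operator is $Kf=\sum_{n=1}^\infty\sum_{i=1}^n f_{n,i}\chi_{E_n}$ for measurable $f$ on $[0,1]$, where the $E_n\subset[0,1]$ are disjoint with $m(E_n)=1/(e\,n!)$, each $f_{n,i}$ is distributed as $f$, and for each $n$ the functions $f_{n,1},\dots,f_{n,n},\chi_{E_n}$ are independent (the $f_{n,i}$ can be realized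 so that $K$ is linear); equivalently, $Kf$ is distributed as $\sum_{i=1}^Nf_i$ with $f_i$ independent copies of $f$ and $N$ an independent Poisson variable with parameter $1$. $K$ is bounded from $E$ into $E''$ if $\|Kf\|_{E''}\le C'\|f\|_E$ for all $f\in E$ and some constant $C'$. *)

(* Defs.v *)
From HB Require Import structures.
From mathcomp Require Import all_boot all_order all_algebra finmap.
From mathcomp Require Import all_classical all_reals all_analysis.

Set Implicit Arguments.
Unset Strict Implicit.
Unset Printing Implicit Defensive.

Import Order.TTheory GRing.Theory Num.Theory.
Import numFieldNormedType.Exports.

Local Open Scope classical_set_scope.
Local Open Scope ring_scope.

(* A function on I is a function on the whole line of which only the values on
   I matter; measurable means Borel measurable, which loses no class modulo
   a.e. equality.  A space is given by a norm N with values in [0, +oo] on all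
   functions, the space itself being the set where N is finite. *)
Section FunctionSpaces.
Context {R : realType}.
Implicit Types (I D : set R) (N : (R -> R) -> \bar R) (f g x y : R -> R).

Local Notation m := (@lebesgue_measure R).

Definition unit_interval : set R := `[0, 1].
Definition half_line : set R := `]0, +oo[.

Definition in_space I N f : Prop := measurable_fun I f /\ (N f < +oo)%E.

Definition equimeasurable I x y : Prop :=
  forall tau : R, 0 < tau ->
    m (I `&` [set t | tau < `|x t|]) = m (I `&` [set t | tau < `|y t|]).

Record ri_space I N : Prop := {
  ri_ge0 : forall f, (0 <= N f)%E;
  ri_definite : forall f, in_space I N f -> N f = 0%E -> ae_eq m I f (cst 0);
  ri_homogeneous : forall (a : R) f, in_space I N f ->
    N (fun t => a * f t) = (`|a|%:E * N f)%E;
  ri_triangle : forall f g, in_space I N f -> in_space I N g ->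
    (N (fun t => f t + g t)%R <= N f + N g)%E;
  ri_nonzero : exists f, in_space I N f /\ ~ ae_eq m I f (cst 0);
  ri_complete : forall u : nat -> R -> R,
    (forall n, in_space I N (u n)) ->
    (forall e : R, 0 < e -> exists n0, forall p q, (n0 <= p)%N -> (n0 <= q)%N ->
      (N (fun t => u p t - u q t)%R < e%:E)%E) ->
    exists f, in_space I N f /\
      (fun n => N (fun t => u n t - f t)%R) @ \oo --> 0%E;
  ri_ideal : forall x y, measurable_fun I x -> in_space I N y ->
    {ae m, forall t, I t -> `|x t| <= `|y t|} -> (N x <= N y)%E;
  ri_rearrangement : forall x y, measurable_fun I x -> in_space I N y ->
    equimeasurable I x y -> N x = N y
}.

Definition ri_space01 N : Prop :=
  ri_space unit_interval N /\ N (\1_unit_interval) = 1%E.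

Definition fundamental_function N (t : R) : \bar R := N (\1_(`[0, t])).

Definition kothe_dual I N y : \bar R :=
  ereal_sup [set (\int[m]_(t in I) (`|x t * y t|)%:E)%E
            | x in [set x | in_space I N x /\ (N x <= 1)%E]].

(* The rearrangement is extended-valued: on an unbounded I it is identically
   +oo when all the sets {|x| > tau} have infinite measure. *)
Definition rearrangement I x (t : R) : \bar R :=
  ereal_inf [set tau%:E | tau in [set tau : R |
    0 <= tau /\ (m (I `&` [set s | (tau < `|x s|)%R]) <= t%:E)%E]].

(* When f^* takes the value +oo at some t > 0 it is identically +oo, so the
   second term is then +oo and the truncation by fine is harmless. *)
Definition Z_norm N f : \bar R :=
  (N (fun t => fine (rearrangement half_line f t) * \1_unit_interval t)%R +
   Lnorm m 2%:E
     (fun t => rearrangement half_line f t * (\1_(`[1, +oo[) t)%:E))%E.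

Definition closed_span I N (u : nat -> R -> R) : set (R -> R) :=
  [set f | in_space I N f /\
    forall e : R, 0 < e -> exists (n : nat) (c : nat -> R),
      (N (fun t => f t - \sum_(i < n) c i * u i t)%R < e%:E)%E].

Definition U_space N (A : nat -> set R) : set (R -> R) :=
  closed_span half_line (Z_norm N) (fun n => \1_(A n)).

Definition isomorphic_embedding (U : set (R -> R)) N1 D N2
    (T : (R -> R) -> R -> R) : Prop :=
  [/\ forall f, U f -> in_space D N2 (T f),
      forall (a : R) f g, U f -> U g ->
        ae_eq m D (T (fun t => a * f t + g t)) (fun t => a * T f t + T g t) &
      exists c C : R, [/\ 0 < c, 0 < C &
        forall f, U f -> (c%:E * N1 f <= N2 (T f) <= C%:E * N1 f)%E]].

Definition bounded_operator I N1 D N2 (K : (R -> R) -> R -> R) : Prop :=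
  exists C : R, forall f, in_space I N1 f ->
    in_space D N2 (K f) /\ (N2 (K f) <= C%:E * N1 f)%E.

End FunctionSpaces.

Section RandomVariables.
Context {R : realType}.
Implicit Types (f x y : R -> R).

Definition prob01 (A : set R) : \bar R :=
  @lebesgue_measure R (unit_interval `&` A).

Definition identically_distributed x y : Prop :=
  forall B : set R, measurable B -> prob01 (x @^-1` B) = prob01 (y @^-1` B).

Definition symmetrically_distributed x : Prop :=
  identically_distributed x (fun t => - x t).

Definition independent (J : eqType) (X : J -> R -> R) : Prop :=
  forall (s : seq J) (B : J -> set R), uniq s -> (forall j, measurable (B j)) ->
    prob01 (\bigcap_(j in [set` s]) (X j @^-1` B j)) =
    (\prod_(j <- s) prob01 (X j @^-1` B j))%E.

(* K is fixed only up to the choice of the sets E n and of the copies F f n i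
   (f_{n,i+1} in usual notation); all choices give equidistributed K f.  At
   each point at most one term of the series over n is nonzero. *)
Definition kruglov_operator (K : (R -> R) -> R -> R) : Prop :=
  exists (E : nat -> set R) (F : (R -> R) -> nat -> nat -> R -> R),
    [/\ forall n, (0 < n)%N -> [/\ measurable (E n), E n `<=` unit_interval &
          @lebesgue_measure R (E n) = ((expR 1 * (n`!)%:R)^-1)%:E],
        trivIset [set n | (0 < n)%N] E &
        forall f, measurable_fun unit_interval f ->
          [/\ forall n i, (i < n)%N -> measurable_fun unit_interval (F f n i) /\
                identically_distributed (F f n i) f,
              forall n, (0 < n)%N ->
                independent (fun j : option 'I_n =>
                  if j is Some i then F f n i else \1_(E n)) &
              forall t, unit_interval t ->
                K f t = limn (fun p =>
                  \sum_(1 <= n < p) \sum_(i < n) F f n i t * \1_(E n) t)]].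

End RandomVariables.

(* Main.v *)
(* Proof idea.  Let f >= 0 be simple on [0,1] with values v_s taken with
   probability p_s.  Give about p_s l_k of the disjoint sets B_i, i in F_k, the
   coefficient v_s; the resulting combination h of the indicators of the B_i is
   dominated in distribution by f, so W = T h = sum a_i y_i has norm at most
   C ||f||.  Given n indices, with probability at least 1/4 (beta / 2 l_k)^n all
   the corresponding y_i exceed alpha while the rest of the sum is nonnegative
   (by symmetry), and for distinct index sets these events can be made disjoint.
   Counting index sets gives, with theta = beta gamma / 4 and l_k large,
     P(W > alpha tau) >= theta^n / (4 n!) P(f_1 + ... + f_n > tau).
   On the other side, a sum of n copies exceeds tau only if one of its halves
   exceeds tau / 2, so P(Kf > tau) is at most a sum over n of
   2 / n! P(f_1 + ... + f_m > tau / 2) with m about n / 2.  As m! / (n! theta^m)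
   is summable, P(Kf > tau) <= c P(|W| > alpha tau / 2), and since E is r.i. such
   an inequality bounds the norms.  The passage to arbitrary f is Fatou's lemma,
   which is where E'' replaces E.  For the fundamental function, apply the lower
   bound to the event that y_i > alpha for gamma l_k indices at once. *)

Require Import Defs.
From HB Require Import structures.
From mathcomp Require Import all_boot all_order all_algebra finmap.
From mathcomp Require Import all_classical all_reals all_analysis.
From mathcomp Require Import measurable_realfun ring lra zify.

Set Implicit Arguments.
Unset Strict Implicit.
Unset Printing Implicit Defensive.

Import Order.TTheory GRing.Theory Num.Theory.
Import numFieldNormedType.Exports.

Local Open Scope classical_set_scope.
Local Open Scope ring_scope.

(** * Rearrangements *)

Section Rearrangement.
Context {R : realType}.
Implicit Types (I : set R) (f g x : R -> R).

Local Notation m := (@lebesgue_measure R).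

(** Three obstacles shape the argument. First, [P(|y_i| > alpha)] is bounded only from below, while
    disjointness of the events asks the variables outside the chosen set to stay below [alpha],
    which may be very unlikely. The cure is to impose this only on a random set of indices, chosen
    so that every variable behaves as if its tail probability were the same small [q]; since [M]
    variables with [M q <= 1/2] are used, all of them staying low then costs only a factor [1/2].
    Second, each [B_i] may be an infinite union of sets [A_n], and [Z_norm] is only a quasinorm, so
    approximations of the indicators cannot just be added to place [h] in [U_E]. Instead [1_{B_i}]
    in [U_E] forces [phi_E] to be small at the measures of the tails of [B_i], and errors are
    estimated by their support and their supremum. Third, [k] has to be large depending on [f] and
    on the truncation of the Poisson sum, so no constant may depend on [k]. Such [k] exist because
    independence forces the [l_k] to be distinct. Norms are compared only through distribution
    functions: a factor [c] between these costs a factor [c] between the norms. *)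

Definition distr I x (tau : R) : \bar R := m (I `&` [set t | tau < `|x t|]).

Lemma measurable_superlevel I x (tau : R) : measurable I -> measurable_fun I x ->
  measurable (I `&` [set t | tau < `|x t|]).
Proof.
move=> mI mx; have := measurableT_comp (@measurable_realfun.normr_measurable R setT) mx.
move=> /(_ mI `]tau, +oo[%classic (measurable_itv _)).
by congr (measurable _); apply/seteqP; split => t /= [? h]; split=> //;
  move: h; rewrite in_itv/= andbT.
Qed.

Lemma distr_nonincreasing I x (s t : R) : measurable I -> measurable_fun I x ->
  s <= t -> (distr I x t <= distr I x s)%E.
Proof.
move=> mI mx st; apply: le_measure; rewrite ?inE.
- exact: measurable_superlevel.
- exact: measurable_superlevel.
- by move=> u [Iu /= h]; split => //=; exact: le_lt_trans h.
Qed.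

(** Continuity from below along the sets where [|x|] exceeds [tau + 1/(n+1)]; no finiteness of the
    measure is required. *)
Lemma distr_right_continuous I x (tau : R) (a : \bar R) :
  measurable I -> measurable_fun I x ->
  (a < distr I x tau)%E -> exists2 tau', tau < tau' & (a < distr I x tau')%E.
Proof.
move=> mI mx ad.
pose F n := I `&` [set t | tau + n.+1%:R^-1 < `|x t|].
have mF n : measurable (F n) by exact: measurable_superlevel.
have FE : \bigcup_n F n = I `&` [set t | tau < `|x t|].
  apply/seteqP; split => [t [n _ [It /= h]]|t [It /= h]].
    by split=> //=; apply: le_lt_trans h; rewrite lerDl.
  have [n nh] := ltr_add_invr h; exists n => //; split.
have ndF : nondecreasing_seq F.
  move=> p q pq; apply/subsetPset => t [It /= h]; split=> //=.
  by apply: le_lt_trans h; rewrite lerD2l lef_pV2 ?posrE// ler_nat ltnS.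
have cF : m \o F @ \oo --> distr I x tau.
  rewrite /distr -FE; apply: nondecreasing_cvg_mu => //.
  exact: bigcupT_measurable.
have [n _ nF] : \forall n \near \oo, (a < (m \o F) n)%E.
  apply: (cF [set z | (a < z)%E]).
  by apply: open_nbhs_nbhs; split => //; exact: open_ereal_gt_ereal.
exists (tau + n.+1%:R^-1); first by rewrite ltrDl.
exact: (nF n (leqnn n)).
Qed.

Lemma rearrangement_ge0 I x t : (0 <= rearrangement I x t)%E.
Proof. by apply: le_ereal_inf_tmp => _ [tau [/= h _] <-]; rewrite lee_fin. Qed.

(** The generalized inverse relation. Right continuity of the distribution function is what allows
    strict inequalities on both sides. *)
Lemma lt_rearrangement I x (tau t : R) : measurable I -> measurable_fun I x ->
  0 <= tau -> (tau%:E < rearrangement I x t)%E <-> (t%:E < distr I x tau)%E.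
Proof.
move=> mI mx tau0; split => [h|h].
  rewrite ltNge; apply/negP => h'; move: h; rewrite ltNge => /negP; apply.
  by apply: ereal_inf_lbound; exists tau.
have [tau' tt' h'] := distr_right_continuous mI mx h.
apply: (@lt_le_trans _ _ tau'%:E); first by rewrite lte_fin.
apply: le_ereal_inf_tmp => _ [s [/= s0 hs] <-]; rewrite lee_fin leNgt.
apply/negP => st; move: h'; rewrite ltNge => /negP; apply.
by apply: le_trans hs; apply: distr_nonincreasing => //; exact: ltW.
Qed.

(** For [tau >= 0] the superlevel set consists of the [t] below [distr I x tau]: a half-line, the
    whole line or the empty set. *)
Lemma measurable_rearrangement I x : measurable I -> measurable_fun I x ->
  measurable_fun setT (rearrangement I x).
Proof.
move=> mI mx; apply: (measurability _ (ErealGenOInfty.measurableE R)) => //.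
move=> _ [_ [tau ->] <-]; rewrite setTI.
have [tau0|tau0] := leP 0 tau.
  rewrite (_ : _ @^-1` _ = [set t : R | (t%:E < distr I x tau)%E]).
    case: (distr I x tau) => [d| |].
    - rewrite (_ : mkset _ = `]-oo, d[%classic) //.
    - by rewrite (_ : mkset _ = setT)// -subTset => t _ /=; rewrite ltry.
    - by rewrite (_ : mkset _ = set0)// -subset0 => t /=; rewrite ltNge leNye.
  apply/seteqP; split => t /=.
    by rewrite in_itv/= andbT => /lt_rearrangement; exact.
  by move=> /lt_rearrangement h; rewrite in_itv/= andbT; exact: h.
rewrite (_ : _ @^-1` _ = setT)//; rewrite -subTset => t _ /=.
rewrite in_itv/= andbT; apply: lt_le_trans (rearrangement_ge0 _ _ _).
by rewrite lte_fin.
Qed.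

Lemma lebesgue_unit_interval : m unit_interval = 1%E.
Proof. by rewrite /unit_interval lebesgue_measure_itv/= lte_fin ltr01 sube0. Qed.

Lemma measurable_unit_interval : measurable (@unit_interval R).
Proof. exact: measurable_itv. Qed.

Lemma distr_unit_le1 x tau : measurable_fun unit_interval x ->
  (distr unit_interval x tau <= 1)%E.
Proof.
move=> mx; rewrite -lebesgue_unit_interval; apply: le_measure; rewrite ?inE.
- exact: measurable_superlevel measurable_unit_interval mx.
- exact: measurable_unit_interval.
- exact: subIsetl.
Qed.

Lemma distr_unit_fin x tau : measurable_fun unit_interval x ->
  distr unit_interval x tau \is a fin_num.
Proof.
move=> mx; rewrite ge0_fin_numE; last exact: measure_ge0.
by rewrite (le_lt_trans (distr_unit_le1 tau mx))// ltry.
Qed.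

(** Continuity from above, available because the unit interval has finite measure. It makes the
    rearrangement finite at every [t > 0]. *)
Lemma distr_small x (e : R) : measurable_fun unit_interval x -> 0 < e ->
  exists2 tau, 0 <= tau & (distr unit_interval x tau < e%:E)%E.
Proof.
move=> mx e0.
pose F n : set R := unit_interval `&` [set t | n%:R < `|x t|].
have mF n : measurable (F n).
  by apply: measurable_superlevel => //; exact: measurable_unit_interval.
have FE : \bigcap_n F n = set0.
  rewrite -subset0 => t /(_ (Num.truncn `|x t|).+1 Logic.I) [_ /= h].
  by have := lt_trans h (truncnS_gt `|x t|); rewrite ltxx.
have : m \o F @ \oo --> m (\bigcap_n F n).
  apply: nonincreasing_cvg_mu => //.
  - by rewrite (le_lt_trans (distr_unit_le1 _ mx))// ltry.
  - by rewrite FE.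
  - move=> p q pq; apply/subsetPset => t [It /= h]; split=> //=.
    by apply: le_lt_trans h; rewrite ler_nat.
rewrite FE measure0 => cF.
have [n _ nF] : \forall n \near \oo, ((m \o F) n < e%:E)%E.
  apply: (cF [set z | (z < e%:E)%E]).
  by apply: open_nbhs_nbhs; split => //=; exact: open_ereal_lt_ereal.
by exists n%:R => //; exact: (nF n (leqnn n)).
Qed.

(* Set to [0] at [t <= 0]: the rearrangement of an unbounded function is [+oo]
   at [t = 0]. *)
Definition ustar x (t : R) : R :=
  if 0 < t then fine (rearrangement unit_interval x t) else 0.

Lemma rearrangement_unit_fin x (t : R) : measurable_fun unit_interval x ->
  0 < t -> rearrangement unit_interval x t \is a fin_num.
Proof.
move=> mx t0; rewrite ge0_fin_numE; last exact: rearrangement_ge0.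
have [tau tau0 h] := distr_small mx t0.
apply: (@le_lt_trans _ _ tau%:E); last by rewrite ltry.
by apply: ereal_inf_lbound; exists tau => //=; split => //; exact: ltW.
Qed.

Lemma ustar_ge0 x t : 0 <= ustar x t.
Proof. by rewrite /ustar; case: ifP => // _; apply: fine_ge0; exact: rearrangement_ge0. Qed.

Lemma lt_ustar x (tau t : R) : measurable_fun unit_interval x -> 0 <= tau ->
  (tau < ustar x t) = (0 < t) && (t < fine (distr unit_interval x tau)).
Proof.
move=> mx tau0; rewrite /ustar; case: (ltP 0 t) => t0 /=; last by rewrite ltNge tau0.
have h := lt_rearrangement t measurable_unit_interval mx tau0.
rewrite -lte_fin fineK; last exact: rearrangement_unit_fin.
rewrite -[RHS]lte_fin fineK; last exact: distr_unit_fin.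
by apply/idP/idP => /h.
Qed.

Lemma measurable_ustar x : measurable_fun unit_interval x ->
  measurable_fun setT (ustar x).
Proof.
move=> mx; apply: measurable_fun_ifT => //.
  by apply: measurable_fun_ltr.
apply: measurableT_comp => //.
exact: (measurable_rearrangement measurable_unit_interval mx).
Qed.

End Rearrangement.

(** * Domination and dilation in an r.i. space *)

Section RearrangementInvariance.
Context {R : realType}.
Implicit Types (f g x : R -> R) (N : (R -> R) -> \bar R).

Local Notation m := (@lebesgue_measure R).
Local Notation D := (@unit_interval R).

Lemma lebesgue_itvoo (a b : R) : a <= b -> m `]a, b[%classic = (b - a)%:E.
Proof.
rewrite lebesgue_measure_itv/= lte_fin => ab.
have [_|ba] := ltP a b; first by rewrite -EFinD.
by rewrite (@le_anti _ _ a b) ?ab// subrr.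
Qed.

Lemma unit_intervalE (t : R) : D t = (0 <= t <= 1).
Proof. by rewrite /unit_interval/= in_itv. Qed.

Lemma distr_ustar x (tau : R) : measurable_fun D x -> 0 <= tau ->
  distr D (ustar x) tau = distr D x tau.
Proof.
move=> mx tau0; rewrite /distr.
have d1 := distr_unit_le1 tau mx; have df := distr_unit_fin tau mx.
rewrite (_ : _ `&` _ = `]0, fine (distr D x tau)[%classic).
  rewrite lebesgue_itvoo ?subr0 ?fineK//; apply: fine_ge0; exact: measure_ge0.
have d1' : fine (distr D x tau) <= 1 by rewrite -lee_fin fineK.
apply/seteqP; split => t /=; rewrite !in_itv/= ger0_norm ?ustar_ge0// lt_ustar//.
  by case.
move=> /andP[t0 td]; rewrite t0 td unit_intervalE (ltW t0); split => //.
by rewrite (le_trans (ltW td)).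
Qed.

Lemma ustar_le x g : measurable_fun D x -> measurable_fun D g ->
  (forall tau : R, 0 < tau -> (distr D x tau <= distr D g tau)%E) ->
  forall t, ustar x t <= ustar g t.
Proof.
move=> mx mg xg t; rewrite leNgt; apply/negP => h.
pose tau := (ustar g t + ustar x t) / 2.
have tau0 : 0 < tau by have := ustar_ge0 g t; rewrite /tau; lra.
have : tau < ustar x t by rewrite /tau; lra.
rewrite lt_ustar ?(ltW tau0)// => /andP[t0 h1].
have : tau < ustar g t.
  rewrite lt_ustar ?(ltW tau0)// t0 (lt_le_trans h1)//.
  by apply: fine_le; rewrite ?distr_unit_fin ?xg.
by rewrite /tau; lra.
Qed.

Variable N : (R -> R) -> \bar R.
Hypothesis ri : ri_space D N.

Lemma ri_fin f : in_space D N f -> N f \is a fin_num.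
Proof. by case=> _ h; rewrite ge0_fin_numE//; exact: (ri_ge0 ri). Qed.

Lemma ri_ustar g : in_space D N g -> N (ustar g) = N g.
Proof.
move=> gN; have mg := gN.1; apply: (ri_rearrangement ri) => //.
  by apply: measurable_funTS; exact: measurable_ustar.
by move=> tau /ltW tau0; exact: distr_ustar.
Qed.

(** The axioms know only pointwise domination and equality in distribution. Domination in
    distribution reduces to these two through the pointwise inequality between the
    rearrangements. *)
Lemma ri_dominated x g : measurable_fun D x -> in_space D N g ->
  (forall tau : R, 0 < tau -> (distr D x tau <= distr D g tau)%E) -> (N x <= N g)%E.
Proof.
move=> mx gN xg; have mg := gN.1.
have mxs : measurable_fun D (ustar x).
  by apply: measurable_funTS; exact: measurable_ustar.
have mgs : measurable_fun D (ustar g).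
  by apply: measurable_funTS; exact: measurable_ustar.
have gsN : in_space D N (ustar g) by split; rewrite ?ri_ustar//; exact: gN.2.
have h : (N (ustar x) <= N (ustar g))%E.
  apply: (ri_ideal ri) => //; apply: aeW => t _.
  by rewrite !ger0_norm ?ustar_ge0//; exact: ustar_le.
rewrite (ri_rearrangement ri mx (y := ustar x)).
- by rewrite -(ri_ustar gN).
- by split => //; apply: le_lt_trans h gsN.2.
- by move=> tau /ltW tau0; rewrite -[LHS]distr_ustar.
Qed.

Lemma in_space_dominated x g : measurable_fun D x -> in_space D N g ->
  (forall tau : R, 0 < tau -> (distr D x tau <= distr D g tau)%E) -> in_space D N x.
Proof.
by move=> mx gN xg; split => //; apply: le_lt_trans (ri_dominated mx gN xg) gN.2.
Qed.

Lemma in_space_scale (a : R) f : in_space D N f -> in_space D N (fun t => a * f t).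
Proof.
move=> fN; split; first by apply: measurable_funM => //; exact: fN.1.
by rewrite (ri_homogeneous ri)// -(fineK (ri_fin fN)) -EFinM ltry.
Qed.

Lemma in_space_add f g : in_space D N f -> in_space D N g ->
  in_space D N (fun t => f t + g t).
Proof.
move=> fN gN; split; first by apply: measurable_funD; [exact: fN.1|exact: gN.1].
apply: le_lt_trans (ri_triangle ri fN gN) _.
by rewrite lte_add_pinfty//; [exact: fN.2|exact: gN.2].
Qed.

Lemma ri_norm0 : N (cst 0) = 0%E.
Proof.
have [f [fN _]] := ri_nonzero ri.
have := ri_homogeneous ri 0 fN.
rewrite normr0 mul0e => <-; congr N; apply/funext => t.
by rewrite mul0r.
Qed.

Lemma in_space0 : in_space D N (cst 0).
Proof. by split; [exact: measurable_cst|rewrite ri_norm0]. Qed.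

Lemma ri_sum (c : nat) (z : nat -> R -> R) : (forall u, (u < c)%N -> in_space D N (z u)) ->
  in_space D N (fun t => \sum_(u < c) z u t) /\
  (N (fun t => (\sum_(u < c) z u t)%R) <= \sum_(u < c) N (z u))%E.
Proof.
elim: c => [|c IH] zN.
  under eq_fun do rewrite big_ord0.
  by rewrite big_ord0 ri_norm0; split => //; exact: in_space0.
have [IH1 IH2] := IH (fun u uc => zN u (ltnW uc)).
under eq_fun do rewrite big_ord_recr/=.
split; first exact/in_space_add/zN.
rewrite big_ord_recr/=; apply: le_trans (ri_triangle ri IH1 (zN c _)) _ => //.
by rewrite leeD2r.
Qed.

(* The function [t |-> x^*(c t - u)] lives on an interval of length [1/c], and
   its distribution function is that of [x] divided by [c]. *)
Lemma ri_dilation (c : nat) x g : (0 < c)%N ->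
  measurable_fun D x -> in_space D N g ->
  (forall tau : R, 0 < tau -> (distr D x tau <= c%:R%:E * distr D g tau)%E) ->
  (N x <= c%:R%:E * N g)%E.
Proof.
move=> c0 mx gN xg; have mg := gN.1.
have c0' : 0 < c%:R :> R by rewrite ltr0n.
pose z u t := ustar x (c%:R * t - u%:R).
have z_ge0 u t : 0 <= z u t by exact: ustar_ge0.
have mz u : measurable_fun D (z u).
  apply: measurable_funTS; apply: measurableT_comp; first exact: measurable_ustar.
  apply: measurable_funB => //; exact: measurable_funM.
pose itv tau u : set R := `]u%:R / c%:R, (u%:R + fine (distr D x tau)) / c%:R[%classic.
have d1 tau : fine (distr D x tau) <= 1.
  by rewrite -lee_fin fineK ?distr_unit_le1 ?distr_unit_fin.
have d0 tau : 0 <= fine (distr D x tau) by apply: fine_ge0; exact: measure_ge0.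
have zE u (tau : R) : (u < c)%N -> 0 < tau -> D `&` [set t | tau < `|z u t|] = itv tau u.
  move=> uc tau0; apply/seteqP; split => t; rewrite /itv /= in_itv/=.
    rewrite ger0_norm ?z_ge0// lt_ustar ?(ltW tau0)// subr_gt0 ltrBlDl.
    by move=> [_]; rewrite ltr_pdivrMr// ltr_pdivlMr// mulrC.
  rewrite ger0_norm ?z_ge0// lt_ustar ?(ltW tau0)// subr_gt0 ltrBlDl.
  rewrite ltr_pdivrMr// ltr_pdivlMr// mulrC => /andP[h1 h2]; split; last first.
    by rewrite h1.
  rewrite unit_intervalE -(ler_pM2l c0') mulr0 (le_trans _ (ltW h1))//=.
  rewrite -(ler_pM2l c0') mulr1 (le_trans (ltW h2))//.
  have : u%:R + 1 <= c%:R :> R by rewrite natr1 ler_nat.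
  by have := d1 tau; lra.
have mitv tau u : m (itv tau u) = (fine (distr D x tau) / c%:R)%:E.
  rewrite /itv lebesgue_itvoo; first by rewrite -mulrBl [_ + fine _]addrC addrK.
  by rewrite ler_pM2r ?invr_gt0// lerDl.
have zN u : (u < c)%N -> in_space D N (z u) /\ (N (z u) <= N g)%E.
  move=> uc; suff h : forall tau : R, 0 < tau -> (distr D (z u) tau <= distr D g tau)%E.
    by split; [exact: in_space_dominated h|exact: ri_dominated h].
  move=> tau tau0; rewrite [leLHS]/distr zE// mitv.
  have := xg _ tau0; rewrite -(fineK (distr_unit_fin tau mx)).
  rewrite -(fineK (distr_unit_fin tau mg)) -EFinM !lee_fin.
  by rewrite ler_pdivrMr// mulrC.
have [szN leN] := ri_sum (fun u uc => (zN u uc).1).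
(* The superlevel sets of the [c] functions [z u] are disjoint intervals of equal length, whose
   total length is [distr D x tau]; hence the sum of the [z u] dominates [x] in distribution. *)
apply: (@le_trans _ _ (N (fun t => \sum_(u < c) z u t))).
  apply: ri_dominated => // tau tau0.
  have : m (\big[setU/set0]_(u < c) itv tau u) = distr D x tau.
    rewrite measure_bigsetU//=.
    - under eq_bigr do rewrite mitv.
      rewrite sumEFin sumr_const card_ord -[RHS](fineK (distr_unit_fin tau mx)).
      by congr EFin; rewrite -[LHS]mulr_natr mulfVK// gt_eqF.
    - by move=> i; exact: measurable_itv.
    - suff H i j t : (i < j)%N -> itv tau i t -> itv tau j t -> False.
        apply/trivIsetP => i j _ _ ij; rewrite -subset0 => t [h1 h2].
        have [lij|lji|eij] := ltngtP i j; first exact: H h1 h2.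
          exact: H h2 h1.
        by move: ij; rewrite eij eqxx.
      move=> ij; rewrite /itv /= !in_itv/= => /andP[_ h1] /andP[h2 _].
      have := lt_trans h2 h1; rewrite ltr_pM2r ?invr_gt0//.
      have : i%:R + 1 <= j%:R :> R by rewrite natr1 ler_nat.
      by have := d1 tau; lra.
  move=> <-; apply: le_measure; rewrite ?inE.
  - by apply: bigsetU_measurable => u _; exact: measurable_itv.
  - by apply: measurable_superlevel; [exact: measurable_unit_interval|exact: szN.1].
  - rewrite -bigcup_mkord => t [u /= uc]; rewrite -zE// => -[Dt /= h].
    split => //=; apply: (lt_le_trans h).
    rewrite !ger0_norm ?z_ge0 ?sumr_ge0//.
    by rewrite (bigD1 (Ordinal uc))//= lerDl sumr_ge0.
apply: (le_trans leN).
apply: (@le_trans _ _ (\sum_(u < c) N g)%E).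
  by apply: lee_sum => u _; exact: (zN u _).2.
rewrite -(fineK (ri_fin gN)) sumEFin sumr_const card_ord -EFinM.
by rewrite lee_fin mulr_natl.
Qed.

End RearrangementInvariance.

(** * The norm of Z_E *)

Section ZNorm.
Context {R : realType}.
Implicit Types (f g h x : R -> R) (N : (R -> R) -> \bar R).

Local Notation m := (@lebesgue_measure R).
Local Notation D := (@unit_interval R).
Local Notation H := (@half_line R).

Lemma measurable_half_line : measurable H.
Proof. exact: measurable_itv. Qed.

Lemma distr_indic (I B : set R) (tau : R) : 0 <= tau < 1 ->
  distr I \1_B tau = m (I `&` B).
Proof.
move=> /andP[tau0 tau1]; rewrite /distr; congr (m (_ `&` _)).
apply/seteqP; split => t /=; rewrite indicE.
  case: (pselect (B t)) => // Bt; rewrite memNset// normr0 => h.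
  by have := lt_le_trans h tau0; rewrite ltxx.
by move=> Bt; rewrite mem_set// normr1.
Qed.

Lemma distr_ge_bound (I : set R) x (M tau : R) :
  (forall t, I t -> `|x t| <= M) -> M <= tau -> distr I x tau = 0%E.
Proof.
move=> xM Mt; rewrite /distr (_ : _ `&` _ = set0) ?measure0//.
rewrite -subset0 => t [It /= h].
by have := lt_le_trans h (le_trans (xM t It) Mt); rewrite ltxx.
Qed.

Lemma normr_indic_le1 (B : set R) t : `|\1_B t| <= 1 :> R.
Proof. by rewrite indicE; case: (_ \in _); rewrite ?normr1 ?normr0. Qed.

Lemma lebesgue_initial (s : R) : 0 <= s <= 1 -> m (D `&` `[0, s]%classic) = s%:E.
Proof.
move=> /andP[s0 s1]; rewrite setIidr; last first.
  move=> t /=; rewrite unit_intervalE in_itv/= => /andP[-> ts].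
  exact: le_trans ts s1.
rewrite lebesgue_measure_itv/= lte_fin; case: ltP => h; first by rewrite sube0.
by congr EFin; apply/esym/le_anti; rewrite h s0.
Qed.

Variable N : (R -> R) -> \bar R.
Hypothesis ri01 : ri_space01 N.

Let ri : ri_space D N := ri01.1.

Lemma in_space_bounded x (M : R) : measurable_fun D x ->
  (forall t, D t -> `|x t| <= M) -> in_space D N x.
Proof.
move=> mx xM; have D0 : D 0 by rewrite unit_intervalE lexx ler01.
have M0 : 0 <= M by exact: le_trans (normr_ge0 _) (xM _ D0).
have h1 : in_space D N \1_D.
  split; first exact: measurable_indic measurable_unit_interval.
  by rewrite ri01.2 ltry.
have h2 := in_space_scale ri M h1; split => //.
apply: le_lt_trans h2.2; apply: (ri_ideal ri) => //; apply: aeW => t Dt.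
by rewrite indicE mem_set// mulr1 (ger0_norm M0) xM.
Qed.

Lemma in_space_initial (s : R) : in_space D N \1_(`[0, s]).
Proof.
apply: (@in_space_bounded _ 1) => //.
by move=> t _; exact: normr_indic_le1.
Qed.

Lemma distr_initial_le (s tau : R) : 0 <= s <= 1 -> 0 <= tau ->
  distr D \1_(`[0, s]) tau = (if tau < 1 then s%:E else 0%E).
Proof.
move=> s01 tau0; case: ltP => h.
  by rewrite distr_indic ?tau0// lebesgue_initial.
by apply: distr_ge_bound h => t _; exact: normr_indic_le1.
Qed.

Lemma fundamental_dilation (c : nat) (s s' : R) : (0 < c)%N ->
  0 <= s <= 1 -> 0 <= s' <= 1 -> s <= c%:R * s' ->
  (fundamental_function N s <= c%:R%:E * fundamental_function N s')%E.
Proof.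
move=> c0 s01 s'01 ss'; apply: ri_dilation => //.
- exact: in_space_initial.
- move=> tau /ltW tau0; rewrite !distr_initial_le//.
  by case: ifP => _; rewrite ?mule0// -EFinM lee_fin.
Qed.

Definition Zmain h (t : R) : R := fine (rearrangement H h t) * \1_D t.

Lemma measurable_Zmain h : measurable_fun H h -> measurable_fun D (Zmain h).
Proof.
move=> mh; apply: measurable_funTS; apply: measurable_funM.
  apply: measurableT_comp => //.
  exact: measurable_rearrangement measurable_half_line mh.
exact: measurable_indic measurable_unit_interval.
Qed.

(** At [tau = 0] the hypothesis says that [h] lives on a set of measure at most 1, so its
    rearrangement vanishes on [[1, oo)] and the [L^2] term is zero. What remains is a domination in
    distribution on [[0,1]]. *)
Lemma Z_norm_le h x : measurable_fun H h -> in_space D N x ->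
  (forall tau : R, 0 <= tau -> (distr H h tau <= distr D x tau)%E) ->
  (Z_norm N h <= N x)%E.
Proof.
move=> mh xN hx; have mx := xN.1.
rewrite /Z_norm -[leRHS]adde0; apply: leeD.
  apply: (@ri_dominated _ _ ri (Zmain h)) => //; first exact: measurable_Zmain.
  move=> tau tau0; apply: le_trans (hx _ (ltW tau0)).
  have [dh|dh] := eqVneq (distr H h tau) +oo%E; first by rewrite dh leey.
  have dhf : distr H h tau \is a fin_num.
    by rewrite ge0_fin_numE ?measure_ge0// ltey.
  have d0 : 0 <= fine (distr H h tau) by apply: fine_ge0; exact: measure_ge0.
  apply: (@le_trans _ _ (m `[0, fine (distr H h tau)]%classic)).
    apply: le_measure; rewrite ?inE.
    - apply: measurable_superlevel; first exact: measurable_unit_interval.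
      exact: measurable_Zmain.
    - exact: measurable_itv.
    - move=> t [/= Dt]; rewrite /Zmain indicE mem_set// mulr1.
      rewrite ger0_norm; last by apply: fine_ge0; exact: rearrangement_ge0.
      move=> th; have : (tau%:E < rearrangement H h t)%E.
        move: th; case: rearrangement => [r| |]/=; rewrite ?lte_fin ?ltry//.
        by move=> th; have := lt_trans tau0 th; rewrite ltxx.
      move/(lt_rearrangement t measurable_half_line mh (ltW tau0)).
      rewrite -(fineK dhf) lte_fin in_itv/= => /ltW ->.
      by move: Dt; rewrite unit_intervalE => /andP[->].
  rewrite lebesgue_measure_itv/= lte_fin; case: ltP => h'; last exact: measure_ge0.
  by rewrite sube0 fineK.
rewrite (_ : (fun t => _) = cst 0%E); last first.
  apply/funext => t /=; rewrite indicE; case: (boolP (t \in _)) => ht; last first.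
    by rewrite mule0.
  rewrite mule1; apply/eqP; rewrite eq_le rearrangement_ge0 andbT.
  apply: ereal_inf_lbound; exists 0 => //=; split => //.
  apply: (le_trans (hx 0 (lexx _))); apply: (le_trans (distr_unit_le1 _ mx)).
  by move: ht; rewrite inE/= in_itv/= andbT lee_fin.
by rewrite Lnorm0.
Qed.

(** Such an [h] is dominated in distribution by [M] times the indicator of [[0, s]]. This estimate
    replaces a triangle inequality for [Z_norm]. *)
Lemma Z_norm_bounded_le h (B : set R) (M s : R) : measurable_fun H h ->
  measurable B -> (forall t, H t -> `|h t| <= M) -> (forall t, ~ B t -> h t = 0) ->
  0 <= s <= 1 -> (m B <= s%:E)%E ->
  (Z_norm N h <= M%:E * fundamental_function N s)%E.
Proof.
move=> mh mB hM hB s01 Bs.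
have M0 : 0 <= M.
  have H1 : H 1 by rewrite /half_line/= in_itv/= ltr01.
  exact: le_trans (normr_ge0 _) (hM _ H1).
rewrite -{1}(ger0_norm M0) -(ri_homogeneous ri M (in_space_initial s)).
apply: Z_norm_le => //; first exact/in_space_scale/in_space_initial.
move=> tau tau0; have [Mt|tM] := leP M tau.
  by rewrite (distr_ge_bound hM Mt) measure_ge0.
have M0' : 0 < M by exact: le_lt_trans tM.
apply: (@le_trans _ _ s%:E).
  apply: le_trans Bs; apply: le_measure; rewrite ?inE//.
    by apply: measurable_superlevel => //; exact: measurable_half_line.
  move=> t [/= _ th]; apply: contrapT => /hB h0; move: th.
  by rewrite h0 normr0 ltNge tau0.
rewrite (_ : distr _ _ _ = distr D \1_(`[0, s]) (tau / M)).
  rewrite distr_initial_le ?divr_ge0//.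
  by rewrite ltr_pdivrMr// mul1r tM.
rewrite /distr; congr (m (_ `&` _)); apply/seteqP; split => t /=.
  by rewrite normrM (ger0_norm M0) ltr_pdivrMr// mulrC.
by rewrite normrM (ger0_norm M0) ltr_pdivrMr// mulrC.
Qed.

(** The rearrangement of [h] is at least 1 below [s]. The bound [M] keeps it finite at every [t] in
    [[0,1]], so that [fine] never turns [+oo] into 0. *)
Lemma fundamental_le_Z_norm h (M s : R) : measurable_fun H h ->
  (Z_norm N h < +oo)%E -> (forall t, H t -> `|h t| <= M) -> 0 <= s <= 1 ->
  (forall tau : R, 0 <= tau < 1 -> (s%:E <= distr H h tau)%E) ->
  (fundamental_function N s <= Z_norm N h)%E.
Proof.
move=> mh hN hM s01 sh.
have M0 : 0 <= M.
  have H1 : H 1 by rewrite /half_line/= in_itv/= ltr01.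
  exact: le_trans (normr_ge0 _) (hM _ H1).
have le1 : (N (Zmain h) <= Z_norm N h)%E.
  by rewrite /Z_norm leeDl// Lnorm_ge0.
have inZ : in_space D N (Zmain h).
  by split; [exact: measurable_Zmain|exact: le_lt_trans hN].
apply: (le_trans _ le1); apply: ri_dominated => //.
move=> tau /ltW tau0; rewrite distr_initial_le//; case: ifP => tau1; last first.
  exact: measure_ge0.
rewrite -(lebesgue_initial s01).
(* The endpoint [s] is dropped because [lt_rearrangement] asks for [t] strictly below the
   distribution function. *)
have : m (D `&` `[0, s[%classic) = m (D `&` `[0, s]%classic).
  rewrite lebesgue_initial// setIidr; last first.
    move=> t /=; rewrite unit_intervalE in_itv/= => /andP[-> /ltW ts].
    by case/andP: s01 => _; exact: le_trans ts.
  rewrite lebesgue_measure_itv/= lte_fin; case: ltP => h'; first by rewrite sube0.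
  by congr EFin; apply/esym/le_anti; rewrite h'; case/andP: s01.
move=> <-; apply: le_measure; rewrite ?inE.
- by apply: measurableI; [exact: measurable_unit_interval|exact: measurable_itv].
- apply: measurable_superlevel; first exact: measurable_unit_interval.
  exact: measurable_Zmain.
- move=> t [Dt /=]; rewrite in_itv/= => /andP[_ ts]; split => //.
  rewrite /Zmain indicE mem_set// mulr1.
  rewrite ger0_norm; last by apply: fine_ge0; exact: rearrangement_ge0.
  have : (t%:E < distr H h tau)%E.
    by apply: (lt_le_trans _ (sh tau _)); rewrite ?tau0// lte_fin.
  move/(lt_rearrangement t measurable_half_line mh tau0).
  have : (rearrangement H h t < +oo)%E.
    apply: (@le_lt_trans _ _ M%:E); last by rewrite ltry.
    apply: ereal_inf_lbound; exists M => //=; split => //.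
    rewrite [leLHS](distr_ge_bound hM)// lee_fin.
    by move: Dt; rewrite unit_intervalE => /andP[].
  by case: rearrangement => [r| |]//=; rewrite lte_fin.
Qed.

End ZNorm.

(** * The span U_E *)

Section Span.
Context {R : realType}.
Local Notation m := (@lebesgue_measure R).
Local Notation D := (@unit_interval R).
Local Notation H := (@half_line R).

Variable A : nat -> set R.
Hypothesis mA : forall n, measurable (A n).
Hypothesis AH : forall n, A n `<=` H.
Hypothesis A_disj : trivIset [set: nat] A.

Local Notation B S := (\bigcup_(n in S) A n).

Lemma measurable_B (S : set nat) : measurable (B S).
Proof. exact: bigcup_measurable. Qed.

Lemma B_subset (S : set nat) : B S `<=` H.
Proof. by apply: bigcup_sub => n _; exact: AH. Qed.

Lemma lebesgue_B (S : set nat) : m (B S) = (\esum_(n in S) m (A n))%E.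
Proof.
rewrite measure_bigcup//; [|by move=> i _; exact: mA|exact: sub_trivIset A_disj].
by rewrite nneseries_esum//; congr esum; apply/seteqP; split => i /=; rewrite ?inE.
Qed.

Lemma disjoint_B (S S' : set nat) : S `&` S' = set0 -> B S `&` B S' = set0.
Proof.
move=> SS'; rewrite -subset0 => t [[i Si Ai] [j Sj Aj]].
have ij : i = j by apply: (A_disj (i := i) (j := j)) => //; exists t.
suff : (S `&` S') i by rewrite SS'.
by split => //; rewrite ij.
Qed.

Definition tailB (S : set nat) (n : nat) : set R :=
  B S `\` \big[setU/set0]_(i < n) A i.

Lemma measurable_tailB S n : measurable (tailB S n).
Proof.
by apply: measurableD; [exact: measurable_B|exact: bigsetU_measurable].
Qed.

(** Since the [A i] are disjoint, at most one of them contains [t], and the truncated sum removes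
    exactly the first [n]. *)
Lemma indic_tailB (S : set nat) n t :
  \1_(B S) t - \sum_(i < n) \1_S (i : nat) * \1_(A i) t = \1_(tailB S n) t :> R.
Proof.
have [[i0 Si0 Ai0]|nB] := pselect (B S t); last first.
  rewrite !indicE [t \in B S]memNset// [t \in tailB S n]memNset; last by case.
  rewrite big1 ?subr0// => i _; rewrite !indicE.
  have [Si|nSi] := pselect (S i); last by rewrite memNset// mul0r.
  rewrite [t \in _]memNset ?mulr0// => Ai; apply: nB; by exists i.
have A0 i : i != i0 -> \1_(A i) t = 0 :> R.
  move=> /eqP ii0; rewrite indicE memNset// => Ai; apply: ii0.
  by apply: (A_disj (i := i) (j := i0)) => //; exists t.
rewrite [in LHS]indicE mem_set; last by exists i0.
have [i0n|ni0] := ltnP i0 n.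
  rewrite (bigD1 (Ordinal i0n))//= big1 ?addr0; last first.
    by move=> i /eqP ii; rewrite A0 ?mulr0//; apply/eqP => h; apply: ii; exact: val_inj.
  rewrite !indicE mem_set// mem_set// mulr1 subrr memNset//.
  by move=> [_]; apply; rewrite -bigcup_mkord; exists i0.
rewrite big1 ?subr0; last first.
  move=> i _; rewrite A0 ?mulr0//; apply/eqP => ii.
  by have := ltn_ord i; rewrite ii ltnNge ni0.
rewrite indicE mem_set//; split; first by exists i0.
rewrite -bigcup_mkord => -[i /= iltn Ai].
have ii : i = i0 by apply: (A_disj (i := i) (j := i0)) => //; exists t.
by move: iltn; rewrite ii ltnNge ni0.
Qed.

Variable N : (R -> R) -> \bar R.
Hypothesis ri01 : ri_space01 N.

Lemma measurable_lincomb (I : Type) (s : seq I) (a : I -> R) (C : I -> set R) :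
  (forall i, measurable (C i)) ->
  measurable_fun setT (fun t => \sum_(i <- s) a i * \1_(C i) t).
Proof.
by move=> mC; apply: measurable_sum => i; exact: measurable_funM.
Qed.

Lemma normr_lincomb_le (I : Type) (s : seq I) (a : I -> R) (C : I -> set R) t :
  `|\sum_(i <- s) a i * \1_(C i) t| <= \sum_(i <- s) `|a i|.
Proof.
apply: (le_trans (ler_norm_sum _ _ _)); apply: ler_sum => i _.
by rewrite normrM ler_piMr// normr_indic_le1.
Qed.

Lemma tailB_sub S n : tailB S n `<=` H.
Proof. by move=> t [/B_subset]. Qed.

Lemma tailB_mono S n n' : (n <= n')%N -> tailB S n' `<=` tailB S n.
Proof.
move=> nn' t [Bt nt]; split => // h; apply: nt; move: h.
rewrite -!bigcup_mkord => -[i /= ilt Ai]; exists i => //=.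
exact: leq_trans nn'.
Qed.

Lemma tailB_le1 S n : (m (B S) <= 1)%E -> 0 <= fine (m (tailB S n)) <= 1 /\
  m (tailB S n) \is a fin_num.
Proof.
move=> B1; have le1 : (m (tailB S n) <= 1)%E.
  apply: le_trans B1; apply: le_measure; rewrite ?inE.
  - exact: measurable_tailB.
  - exact: measurable_B.
  - exact: subDsetl.
have fn : m (tailB S n) \is a fin_num.
  by rewrite ge0_fin_numE ?measure_ge0// (le_lt_trans le1)// ltry.
split => //; rewrite fine_ge0 ?measure_ge0//=.
by rewrite -lee_fin fineK.
Qed.

(* On the tail of [B S] an approximant built from finitely many [A i] vanishes,
   so the error equals [1] there. *)
Lemma fundamental_tail_le (S : set nat) (e : R) : U_space N A \1_(B S) ->
  (m (B S) <= 1)%E -> 0 < e -> exists n0, forall n, (n0 <= n)%N ->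
  (fundamental_function N (fine (m (tailB S n))) <= e%:E)%E.
Proof.
move=> [_ Uap] B1 e0; have [n0 [c0 hc]] := Uap e e0.
exists n0 => n n0n; have [t01 tf] := tailB_le1 n B1.
set h := (fun t => _ - _) in hc.
have mh : measurable_fun setT h.
  apply: measurable_funB; first exact: measurable_indic (measurable_B S).
  exact: measurable_lincomb.
apply: (le_trans _ (ltW hc)).
apply: (@fundamental_le_Z_norm _ _ ri01 h (1 + \sum_(i < n0) `|c0 i|)) => //.
- exact: measurable_funTS.
- by apply: (lt_trans hc); rewrite ltry.
- move=> t _; apply: (le_trans (ler_normB _ _)); apply: lerD.
    exact: normr_indic_le1.
  exact: (normr_lincomb_le _ (fun i : 'I_n0 => c0 i) (fun i : 'I_n0 => A i)).
- move=> tau /andP[tau0 tau1]; rewrite fineK//; apply: le_measure; rewrite ?inE.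
  + exact: measurable_tailB.
  + apply: measurable_superlevel; first exact: measurable_half_line.
    exact: measurable_funTS.
  + move=> t Bt; split; first exact: tailB_sub Bt.
    have [Bt1 Bt2] := tailB_mono n0n Bt.
    rewrite /= /h indicE mem_set// big1 ?subr0 ?normr1// => i _.
    rewrite indicE memNset ?mulr0// => Ai; apply: Bt2.
    by rewrite -bigcup_mkord; exists i => //=.
Qed.

Lemma seq_argmax (I : eqType) (s : seq I) (F : I -> R) : s != [::] ->
  exists2 j0, j0 \in s & forall j, j \in s -> F j <= F j0.
Proof.
elim: s => // i [|i' s] IH _.
  by exists i; rewrite ?mem_head// => j; rewrite inE => /eqP ->.
have [//|j0 j0s hj0] := IH.
have [h|h] := leP (F i) (F j0).
  exists j0 => [|j]; rewrite inE ?j0s ?orbT// => /orP[/eqP ->//|]; exact: hj0.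
exists i => [|j]; rewrite inE ?eqxx// => /orP[/eqP ->//|/hj0 h'].
exact: le_trans h' (ltW h).
Qed.

Variables (J : eqType) (S : J -> set nat).
Hypothesis BU : forall j, U_space N A \1_(B (S j)).

(** All indicators are truncated to the same first [n] sets [A i]. The error is then bounded by the
    sum of the [|a j|] and supported on the union of the tails, whose measure is at most [size s]
    times the largest tail; [fundamental_tail_le] and [fundamental_dilation] make [phi_E] small
    there. *)
Lemma U_space_lincomb (s : seq J) (a : J -> R) :
  (\sum_(j <- s) m (B (S j)) <= 1)%E ->
  U_space N A (fun t => \sum_(j <- s) a j * \1_(B (S j)) t).
Proof.
move=> s1.
have mh : measurable_fun setT (fun t => \sum_(j <- s) a j * \1_(B (S j)) t).
  by apply: measurable_lincomb => j; exact: measurable_B.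
pose M : R := \sum_(j <- s) `|a j|.
have M0 : 0 <= M by apply: sumr_ge0.
have Bs1 j : j \in s -> (m (B (S j)) <= 1)%E.
  move=> js; apply: le_trans s1; rewrite (big_rem j)//= leeDl//.
  by apply: sume_ge0 => i _; exact: measure_ge0.
have mU (r : seq J) (C : J -> set R) : (forall j, measurable (C j)) ->
    measurable (\big[setU/set0]_(j <- r) C j).
  by move=> mC; apply: big_ind => // *; exact: measurableU.
have leU (C : J -> set R) : (forall j, measurable (C j)) ->
    (m (\big[setU/set0]_(j <- s) C j) <= \sum_(j <- s) m (C j))%E.
  move=> mC; elim: (s) => [|j s' IH]; first by rewrite !big_nil measure0.
  rewrite !big_cons; apply: le_trans (leeD2l _ IH).
  apply: measureU2; [exact: mC|exact: (mU s' C mC)].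
have supp0 (C : J -> set R) t : ~ (\big[setU/set0]_(j <- s) C j) t ->
    \sum_(j <- s) a j * \1_(C j) t = 0.
  elim: (s) => [|j s' IH]; first by move=> _; rewrite big_nil.
  rewrite !big_cons => nt; rewrite IH ?addr0; last by move=> h; apply: nt; right.
  by rewrite indicE memNset ?mulr0// => h; apply: nt; left.
split.
  split; first exact: measurable_funTS.
  apply: (@le_lt_trans _ _ (M%:E * fundamental_function N 1)%E).
    apply: (@Z_norm_bounded_le _ _ ri01 _ (\big[setU/set0]_(j <- s) B (S j))) => //.
    - exact: measurable_funTS.
    - by apply: mU => j; exact: measurable_B.
    - by move=> t _; exact: normr_lincomb_le.
    - by move=> t; exact: supp0.
    - by rewrite ler01 lexx.
    - by apply: le_trans s1; apply: leU => j; exact: measurable_B.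
  have h1 : in_space D N \1_(`[0%R, 1%R]) by exact: in_space_initial.
  by rewrite /fundamental_function -(fineK (ri_fin ri01.1 h1)) -EFinM ltry.
move=> e e0.
have [s0|sN0] := eqVneq s [::].
  exists 0, (fun=> 0); rewrite s0; under eq_fun do rewrite big_nil big_ord0 subr0.
  apply: (@le_lt_trans _ _ 0%E); last by rewrite lte_fin.
  have -> : 0%E = (0%:E * fundamental_function N 0)%E :> \bar R by rewrite mul0e.
  apply: (@Z_norm_bounded_le _ _ ri01 _ set0) => //.
  - by move=> t _; rewrite normr0.
  - by rewrite lexx ler01.
  - by rewrite measure0.
pose k := size s.
have k0 : (0 < k)%N by rewrite /k lt0n size_eq0.
(* The factor [k] pays for the passage from the largest tail to the sum of all tails; [M + 1]
   instead of [M] avoids a zero denominator and makes the final inequality strict. *)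
pose e' := e / ((M + 1) * k%:R).
have e'0 : 0 < e' by rewrite divr_gt0// mulr_gt0 ?ltr0n// ltr_wpDl.
have [n hn] : exists n, forall j, j \in s ->
    (fundamental_function N (fine (m (tailB (S j) n))) <= e'%:E)%E.
  have : forall s' : seq J, {subset s' <= s} -> exists n0, forall n, (n0 <= n)%N ->
    forall j, j \in s' -> (fundamental_function N (fine (m (tailB (S j) n))) <= e'%:E)%E.
    elim => [|j s' IH] ss; first by exists 0.
    have [n1 h1] := IH (fun j js => ss j (@mem_behead _ (_ :: _) j js)).
    have [n2 h2] := fundamental_tail_le (BU j) (Bs1 j (ss j (mem_head _ _))) e'0.
    exists (maxn n1 n2) => n; rewrite geq_max => /andP[nn1 nn2] i.
    by rewrite inE => /orP[/eqP ->|]; [exact: h2|exact: h1].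
  by move=> /(_ s (fun j js => js))[n hn]; exists n; exact: hn.
exists n, (fun i => \sum_(j <- s) a j * \1_(S j) i).
rewrite (_ : (fun t => _) = (fun t => \sum_(j <- s) a j * \1_(tailB (S j) n) t)); last first.
  apply/funext => t; under [in RHS]eq_bigr do rewrite -indic_tailB mulrBr mulr_sumr.
  rewrite sumrB; congr (_ - _); rewrite exchange_big/=; apply: eq_bigr => i _.
  by rewrite mulr_suml; apply: eq_bigr => j _; rewrite mulrA.
have [j0 j0s hj0] := seq_argmax (fun j => fine (m (tailB (S j) n))) sN0.
pose s' := \sum_(j <- s) fine (m (tailB (S j) n)).
have tB j : j \in s -> 0 <= fine (m (tailB (S j) n)) <= 1 /\ m (tailB (S j) n) \is a fin_num.
  by move=> js; apply: tailB_le1; exact: Bs1.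
have s'E : (s'%:E = \sum_(j <- s) m (tailB (S j) n))%E.
  rewrite -sumEFin; rewrite big_seq [RHS]big_seq; apply: eq_bigr => j js.
  by rewrite fineK//; have [] := tB j js.
have s'01 : 0 <= s' <= 1.
  rewrite sumr_ge0/=; last by move=> j _; apply: fine_ge0; exact: measure_ge0.
  rewrite -lee_fin s'E; apply: le_trans s1; apply: lee_sum => j _.
  apply: le_measure; rewrite ?inE.
  - exact: measurable_tailB.
  - exact: measurable_B.
  - exact: subDsetl.
apply: (@le_lt_trans _ _ (M%:E * fundamental_function N s')%E).
  apply: (@Z_norm_bounded_le _ _ ri01 _ (\big[setU/set0]_(j <- s) tailB (S j) n)) => //.
  - by apply: measurable_funTS; apply: measurable_lincomb => j; exact: measurable_tailB.
  - by apply: mU => j; exact: measurable_tailB.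
  - by move=> t _; exact: normr_lincomb_le.
  - by move=> t; exact: supp0.
  - by rewrite s'E; apply: leU => j; exact: measurable_tailB.
have ff u : in_space D N \1_(`[0, u]) by exact: in_space_initial.
apply: (@le_lt_trans _ _ (M%:E * (k%:R%:E * e'%:E))%E).
  apply: lee_wpmul2l; first by rewrite lee_fin.
  apply: (le_trans (fundamental_dilation ri01 k0 s'01 (tB j0 j0s).1 _)); last first.
    by rewrite lee_pmul2l ?lte_fin ?ltr0n//; exact: hn.
  rewrite mulr_natl /s' /k; elim: (s) (hj0) => [|j r IH] hr.
    by rewrite big_nil.
  rewrite big_cons /= mulrS; apply: lerD; first exact: hr (mem_head _ _).
  by apply: IH => i ir; apply: hr; rewrite inE ir orbT.
rewrite -!EFinM lte_fin /e' [M * _](_ : _ = e * (M / (M + 1))).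
  by rewrite gtr_pMr// ltr_pdivrMr ?mul1r ?ltrDl// ltr_wpDl.
have : k%:R != 0 :> R by rewrite pnatr_eq0 -lt0n.
have : M + 1 != 0 by rewrite gt_eqF// ltr_wpDl.
by move=> h1 h2; field; rewrite h1 h2.
Qed.

Variable T : (R -> R) -> R -> R.
Hypothesis Tlin : forall (a : R) f g, U_space N A f -> U_space N A g ->
  ae_eq m D (T (fun t => a * f t + g t)) (fun t => a * T f t + T g t).

Lemma T_lincomb (s : seq J) (a : J -> R) :
  (\sum_(j <- s) m (B (S j)) <= 1)%E ->
  ae_eq m D (T (fun t => \sum_(j <- s) a j * \1_(B (S j)) t))
    (fun t => \sum_(j <- s) a j * T \1_(B (S j)) t).
Proof.
elim: s => [|j s IH] s1.
  have U0 := U_space_lincomb a s1.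
  have E0 : (fun t => \sum_(j <- [::]) a j * \1_(B (S j)) t) = cst 0.
    by apply/funext => t; rewrite big_nil.
  (* Linearity with scalar 1 and two zero functions gives [T 0 = T 0 + T 0] a.e., hence [T 0 = 0]
     a.e. *)
  rewrite E0 in U0 *; have := Tlin 1 U0 U0; apply: filterS => t /[apply].
  rewrite (_ : (fun t => _) = cst 0); last by apply/funext => u /=; rewrite mulr0 addr0.
  by rewrite big_nil mul1r => h; lra.
have s1' : (\sum_(j <- s) m (B (S j)) <= 1)%E.
  by apply: le_trans s1; rewrite big_cons leeDr// measure_ge0.
have := Tlin (a j) (BU j) (U_space_lincomb a s1').
apply: filterS2 (IH s1') => t h1 h2 Dt.
rewrite big_cons -(h1 Dt) -(h2 Dt); congr T.
by apply/funext => u; rewrite big_cons.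
Qed.

End Span.

(** * Joint laws *)

Section JointLaw.
Context {R : realType} (n : nat).
Implicit Types Y : 'I_n -> R -> R.

Local Notation m := (@lebesgue_measure R).
Local Notation D := (@unit_interval R).

(* The values of [Y j] outside [0,1] are arbitrary; cutting them off makes the
   map measurable on the whole line. *)
Definition jointmap Y (t : R) : n.-tuple R := [tuple Y j t * \1_D t | j < n].

Lemma measurable_jointmap Y : (forall j, measurable_fun D (Y j)) ->
  measurable_fun setT (jointmap Y).
Proof.
move=> mY; apply/measurable_fun_tnthP => j.
rewrite (_ : _ \o _ = (Y j) \_ D).
  by apply/(measurable_restrictT _ measurable_unit_interval).
apply/funext => t /=; rewrite tnth_mktuple patchE indicE.
by case: ifP; rewrite ?mulr1 ?mulr0.
Qed.

Section law.
Variable Y : 'I_n -> R -> R.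
Hypothesis mY : forall j, measurable_fun D (Y j).

(* The proof argument lets the measure structure be inferred. *)
Definition joint_law of (forall j, measurable_fun D (Y j)) :=
  fun B : set (n.-tuple R) => m (D `&` jointmap Y @^-1` B).

Local Notation law := (joint_law mY).

Lemma measurable_preimage_jointmap (B : set (n.-tuple R)) : measurable B ->
  measurable (D `&` jointmap Y @^-1` B).
Proof.
move=> mB; apply: measurableI; first exact: measurable_unit_interval.
by rewrite -[X in measurable X]setTI; exact: measurable_jointmap.
Qed.

Let law0 : law set0 = 0%E.
Proof. by rewrite /joint_law preimage_set0 setI0 measure0. Qed.

Let law_ge0 B : (0 <= law B)%E.
Proof. exact: measure_ge0. Qed.

Let law_additive : semi_sigma_additive law.
Proof.
move=> F mF tF mUF; rewrite /joint_law preimage_bigcup setI_bigcupr.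
apply: measure_semi_sigma_additive.
- by move=> k; exact: measurable_preimage_jointmap.
- apply/trivIsetP => /= i j _ _ ij; rewrite setIACA -(preimage_setI (jointmap Y)).
  by move/trivIsetP : tF => /(_ _ _ _ _ ij) ->//; rewrite preimage_set0 setI0.
- by rewrite -setI_bigcupr -preimage_bigcup; exact: measurable_preimage_jointmap.
Qed.

HB.instance Definition _ := isMeasure.Build _ _ _ law law0 law_ge0 law_additive.

End law.

Definition rectangles : set (set (n.-tuple R)) :=
  [set [set x | forall j, C j (tnth x j)] |
    C in [set C : 'I_n -> set R | forall j, measurable (C j)]].

Lemma joint_law_rectangle Y (mY : forall j, measurable_fun D (Y j))
    (C : 'I_n -> set R) : independent Y -> (forall j, measurable (C j)) ->
  joint_law mY [set x | forall j, C j (tnth x j)] =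
  (\prod_(j <- enum 'I_n) prob01 (Y j @^-1` C j))%E.
Proof.
move=> iY mC; rewrite -iY ?enum_uniq// /joint_law /prob01; congr (m _).
apply/seteqP; split => t [Dt h]; split => //.
  move=> j _; move: (h j); rewrite tnth_mktuple indicE mem_set// mulr1; exact.
move=> j; rewrite tnth_mktuple indicE mem_set// mulr1.
by apply: (h j); rewrite /= mem_enum.
Qed.

(** By independence both laws give a measurable rectangle the product of the marginals. The
    rectangles are closed under intersection and generate the sigma-algebra, so the laws agree
    everywhere. *)
Lemma joint_law_unique Y Y' (mY : forall j, measurable_fun D (Y j))
    (mY' : forall j, measurable_fun D (Y' j)) (B : set (n.-tuple R)) :
  independent Y -> independent Y' ->
  (forall j, identically_distributed (Y j) (Y' j)) -> measurable B ->
  joint_law mY B = joint_law mY' B.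
Proof.
move=> iY iY' idY; apply: (measure_unique rectangles (fun=> setT)).
- apply/seteqP; split.
    apply: smallest_sub; first exact: smallest_sigma_algebra.
    move=> X; rewrite -bigcup_seq => -[i _ [C mC <-]]; rewrite setTI.
    apply: sub_sigma_algebra; exists (fun j => if j == i then C else setT).
      by move=> j; case: ifP.
    apply/seteqP; split => x /=; first by move=> /(_ i); rewrite eqxx.
    by move=> h j; case: eqP => // ->.
  apply: smallest_sub; first exact: sigma_algebra_measurable.
  move=> _ [C mC <-].
  rewrite (_ : mkset _ = \bigcap_(j in [set` enum 'I_n]) ((@tnth n R)^~ j @^-1` C j)).
    apply: fin_bigcap_measurable => // j _.
    by rewrite -[X in measurable X]setTI; exact: measurable_tnth.
  apply/seteqP; split => x h j; first by move=> _; exact: h.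
  by apply: h; rewrite /= mem_enum.
- move=> _ _ [C mC <-] [C' mC' <-].
  exists (fun j => C j `&` C' j); first by move=> j; exact: measurableI.
  apply/seteqP; split => x /= h; first by split => j; case: (h j).
  by move=> j; split; [exact: h.1|exact: h.2].
- move=> _; exists (fun=> setT); first by move=> j; exact: measurableT.
  by apply/seteqP; split.
- by apply/seteqP; split => // t _; exists 0%N.
- move=> _ [C mC <-] /=.
  rewrite (joint_law_rectangle mY iY mC) (joint_law_rectangle mY' iY' mC).
  by apply: eq_bigr => j _; exact: idY.
- move=> _ /=; rewrite /joint_law preimage_setT setIT lebesgue_unit_interval.
  exact: ltry.
Qed.

End JointLaw.

(** * Sums of independent symmetric variables *)

Section SymmetricSums.
Context {R : realType}.

Local Notation m := (@lebesgue_measure R).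
Local Notation D := (@unit_interval R).

Definition pr (A : set R) : R := fine (prob01 A).

Lemma prob01_fin (A : set R) : measurable (D `&` A) -> prob01 A \is a fin_num.
Proof.
move=> mA; rewrite ge0_fin_numE ?measure_ge0//.
apply: (@le_lt_trans _ _ (m D)); last by rewrite lebesgue_unit_interval ltry.
by apply: le_measure; rewrite ?inE//; exact: measurable_unit_interval.
Qed.

Lemma pr_ge0 A : 0 <= pr A.
Proof. by apply: fine_ge0; exact: measure_ge0. Qed.

Lemma measurable_unit_preimage (x : R -> R) (C : set R) : measurable_fun D x ->
  measurable C -> measurable (D `&` x @^-1` C).
Proof. by move=> mx mC; exact: mx measurable_unit_interval C mC. Qed.

Lemma sum_measure_disjoint_le (I : choiceType) (s : seq I) (F : I -> set R) (X : set R) :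
  uniq s -> (forall i, measurable (F i)) -> measurable X ->
  (forall i j, i \in s -> j \in s -> i != j -> F i `&` F j = set0) ->
  (forall i, i \in s -> F i `<=` X) ->
  (\sum_(i <- s) m (F i) <= m X)%E.
Proof.
move=> us mF mX dF FX.
have mU (r : seq I) : measurable (\big[setU/set0]_(i <- r) F i).
  by apply: big_ind => // *; exact: measurableU.
have -> : (\sum_(i <- s) m (F i) = m (\big[setU/set0]_(i <- s) F i))%E.
  elim: s us dF FX => [|i s IH] /=; first by rewrite !big_nil measure0.
  move=> /andP[ni us] dF FX; rewrite !big_cons IH//.
  - rewrite measureU//; [exact: mF|exact: mU|].
    rewrite -subset0 => t [Fi]; rewrite -bigcup_seq => -[j /= js Fj].
    have ij : i != j by apply: contraNneq ni => ->.
    have /seteqP[dij _] : F i `&` F j = set0.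
      by apply: dF => //; rewrite inE ?eqxx ?js ?orbT.
    by have := dij t; apply.
  - by move=> j k js ks; apply: dF; rewrite inE ?js ?ks orbT.
  - by move=> j js; apply: FX; rewrite inE js orbT.
apply: le_measure; rewrite ?inE//; first exact: mU.
by rewrite -bigcup_seq => t [i /= si]; exact: FX.
Qed.

Variable M : nat.
Variable Y : 'I_M -> R -> R.
Hypothesis mY : forall j, measurable_fun D (Y j).
Hypothesis iY : independent Y.
Hypothesis sY : forall j, symmetrically_distributed (Y j).

Definition flip (J : {set 'I_M}) (j : 'I_M) (t : R) : R :=
  if j \in J then Y j t else - Y j t.

Lemma measurable_flip J j : measurable_fun D (flip J j).
Proof. rewrite /flip; case: (j \in J); [exact: mY|exact: measurableT_comp]. Qed.

Lemma measurable_oppr_preimage (C : set R) : measurable C -> measurable (-%R @^-1` C).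
Proof.
by move=> mC; rewrite -[X in measurable X]setTI; exact: (@oppr_measurable R setT).
Qed.

Lemma flip_preimage J j (C : set R) :
  flip J j @^-1` C = Y j @^-1` (if j \in J then C else -%R @^-1` C).
Proof. by rewrite /flip; case: (j \in J). Qed.

Lemma flip_identically_distributed J j : identically_distributed (Y j) (flip J j).
Proof. by move=> C mC; rewrite /flip; case: (j \in J) => //; exact: sY. Qed.

Lemma flip_independent J : independent (flip J).
Proof.
move=> s C us mC.
have -> : \bigcap_(j in [set` s]) (flip J j @^-1` C j) =
    \bigcap_(j in [set` s]) (Y j @^-1` (if j \in J then C j else -%R @^-1` C j)).
  by apply: eq_bigcapr => j _; rewrite flip_preimage.
rewrite iY//; last by move=> j; case: ifP => _ //; exact: measurable_oppr_preimage.
by apply: eq_bigr => j _; rewrite flip_preimage.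
Qed.

Variable alpha : R.
Hypothesis alpha0 : 0 < alpha.
Variable a : 'I_M -> R.
Hypothesis a0 : forall j, 0 <= a j.

Definition tailp (j : 'I_M) : R := pr [set t | alpha < `|Y j t|].

Let ray : set R := `]alpha, +oo[%classic.
Let core : set R := `[- alpha, alpha]%classic.

Let mray : measurable ray. Proof. exact: measurable_itv. Qed.
Let mcore : measurable core. Proof. exact: measurable_itv. Qed.

Lemma prob01_ray j : prob01 (Y j @^-1` ray) = (tailp j / 2)%:E.
Proof.
have mneg : measurable (-%R @^-1` ray) by exact: measurable_oppr_preimage.
have m1 := measurable_unit_preimage (mY j) mray.
have m2 := measurable_unit_preimage (mY j) mneg.
have E : prob01 (Y j @^-1` (-%R @^-1` ray)) = prob01 (Y j @^-1` ray).
  by rewrite (sY j mray).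
have : prob01 [set t | alpha < `|Y j t|] =
    (prob01 (Y j @^-1` ray) + prob01 (Y j @^-1` (-%R @^-1` ray)))%E.
  rewrite /prob01 -measureU//.
    congr (m _); rewrite -setIUr; congr (_ `&` _).
    apply/seteqP; split => t; rewrite /ray/= !in_itv/= !andbT lter_normr.
      by case/orP; [left|right].
    by case=> ->; rewrite ?orbT.
  rewrite -subset0 => t [[_ h1] [_ h2]]; move: h1 h2.
  by rewrite /ray /= !in_itv/= !andbT => h1 h2; have := alpha0; lra.
rewrite E -(fineK (prob01_fin m1)) -EFinD /tailp /pr => -> /=.
by congr EFin; lra.
Qed.

Lemma prob01_core j : prob01 (Y j @^-1` core) = (1 - tailp j)%:E.
Proof.
have mC : measurable (~` core) by exact: measurableC.
have m1 := measurable_unit_preimage (mY j) mcore.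
have m2 := measurable_unit_preimage (mY j) mC.
have : m D = (prob01 (Y j @^-1` core) + prob01 (Y j @^-1` (~` core)))%E.
  rewrite /prob01 -measureU//.
    by rewrite -setIUr -preimage_setU setUv preimage_setT setIT.
  by rewrite -subset0 => t [[_ h1] [_ h2]].
have -> : Y j @^-1` (~` core) = [set t | alpha < `|Y j t|].
  apply/seteqP; split => t; rewrite /core /= in_itv/= -ler_norml.
    by move/negP; rewrite -ltNge.
  by rewrite ltNge => /negP.
have f2 : prob01 [set t | alpha < `|Y j t|] \is a fin_num.
  by apply: prob01_fin; apply: measurable_superlevel => //; exact: measurable_unit_interval.
rewrite lebesgue_unit_interval -(fineK (prob01_fin m1)) -(fineK f2) -EFinD => -[h].
by congr EFin; rewrite /tailp /pr; lra.
Qed.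

Lemma tailp_le1 j : tailp j <= 1.
Proof.
by have := pr_ge0 (Y j @^-1` core); rewrite /pr prob01_core/=; lra.
Qed.

Definition cell (J Th : {set 'I_M}) (j : 'I_M) : set R :=
  if j \in J then ray else if j \in Th then core else setT.

Definition cellp (J Th : {set 'I_M}) (j : 'I_M) : R :=
  if j \in J then tailp j / 2 else if j \in Th then 1 - tailp j else 1.

Lemma measurable_cell J Th j : measurable (cell J Th j).
Proof. by rewrite /cell; case: ifP => _ //; case: ifP. Qed.

Lemma prob01_cell J Th j : prob01 (Y j @^-1` cell J Th j) = (cellp J Th j)%:E.
Proof.
rewrite /cell /cellp; case: ifP => _; first exact: prob01_ray.
case: ifP => _; first exact: prob01_core.
by rewrite preimage_setT /prob01 setIT lebesgue_unit_interval.
Qed.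

(* Here the variables of [J] exceed [alpha], those of [Th] outside [J] do not,
   and the part of the sum outside [J] is nonnegative, which by symmetry costs a
   factor [2].  For fixed [Th], distinct [J] give disjoint events. *)
Definition event (J Th : {set 'I_M}) : set (M.-tuple R) :=
  [set x | forall j, cell J Th j (tnth x j)] `&`
  [set x | 0 <= \sum_(j | j \notin J) a j * tnth x j].

Definition event' (J Th : {set 'I_M}) : set (M.-tuple R) :=
  [set x | forall j, cell J Th j (tnth x j)] `&`
  [set x | \sum_(j | j \notin J) a j * tnth x j <= 0].

Lemma measurable_rect J Th :
  measurable ([set x | forall j, cell J Th j (tnth x j)] : set (M.-tuple R)).
Proof.
rewrite (_ : mkset _ =
    \bigcap_(j in [set` enum 'I_M]) ((@tnth M R)^~ j @^-1` cell J Th j)).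
  apply: fin_bigcap_measurable => // j _.
  by rewrite -[X in measurable X]setTI; apply: measurable_tnth => //; exact: measurable_cell.
apply/seteqP; split => x h j; first by move=> _; exact: h.
by apply: h; rewrite /= mem_enum.
Qed.

Lemma measurable_partial_sum (J : {set 'I_M}) :
  measurable_fun setT (fun x : M.-tuple R => \sum_(j | j \notin J) a j * tnth x j).
Proof.
under eq_fun do rewrite big_mkcond.
apply: measurable_sum => j; case: (j \notin J) => //.
by apply: measurable_funM => //; exact: measurable_tnth.
Qed.

Lemma measurable_event J Th : measurable (event J Th).
Proof.
apply: measurableI; first exact: measurable_rect.
have := measurable_partial_sum J measurableT (measurable_itv `[0, +oo[).
by rewrite setTI; congr measurable; apply/seteqP; split => x /=; rewrite in_itv/= andbT.
Qed.

Lemma measurable_event' J Th : measurable (event' J Th).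
Proof.
apply: measurableI; first exact: measurable_rect.
have := measurable_partial_sum J measurableT (measurable_itv `]-oo, 0]).
by rewrite setTI; congr measurable; apply/seteqP; split => x /=; rewrite in_itv/=.
Qed.

(** Negating the variables outside [J] preserves the joint law. It also preserves the cells, as
    [core] is symmetric, and it exchanges [event] with [event']. These two cover the rectangle of
    the cells, so each carries at least half of its probability. *)
Lemma joint_law_event J Th : (((\prod_(j < M) cellp J Th j) / 2)%:E <=
  joint_law mY (event J Th))%E.
Proof.
have mf := measurable_flip J.
have E : joint_law mY (event' J Th) = joint_law mY (event J Th).
  rewrite (joint_law_unique mY mf iY (flip_independent J)
    (flip_identically_distributed J) (measurable_event J Th)).
  rewrite /joint_law; congr (m _).
  have fE t j : D t -> tnth (jointmap (flip J) t) j =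
      if j \in J then tnth (jointmap Y t) j else - tnth (jointmap Y t) j.
    by move=> Dt; rewrite !tnth_mktuple /flip indicE mem_set// !mulr1.
  have cE t : D t -> (forall j, cell J Th j (tnth (jointmap Y t) j)) <->
      (forall j, cell J Th j (tnth (jointmap (flip J) t) j)).
    move=> Dt; suff H j : cell J Th j (tnth (jointmap Y t) j) <->
        cell J Th j (tnth (jointmap (flip J) t) j).
      by split => h j; apply/H.
    rewrite fE// /cell; case: ifP => // _; case: ifP => // _.
    by rewrite /core /= !in_itv/= -!ler_norml normrN.
  have sE t : D t -> \sum_(j | j \notin J) a j * tnth (jointmap (flip J) t) j =
      - \sum_(j | j \notin J) a j * tnth (jointmap Y t) j.
    move=> Dt; rewrite -sumrN; apply: eq_bigr => j /negPf jJ.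
    by rewrite fE// jJ mulrN.
  apply/seteqP; split => t [Dt] [h1 h2]; split=> //; split.
  - exact/(cE t Dt).
  - by rewrite /= sE// oppr_ge0.
  - exact/(cE t Dt).
  - by move: h2; rewrite /= sE// oppr_ge0.
have R1 : joint_law mY [set x | forall j, cell J Th j (tnth x j)] =
    (\prod_(j < M) cellp J Th j)%:E.
  rewrite joint_law_rectangle//; last by move=> j; exact: measurable_cell.
  under eq_bigr do rewrite prob01_cell.
  by rewrite -prodEFin big_enum.
have U : (joint_law mY [set x | forall j, cell J Th j (tnth x j)] <=
    joint_law mY (event J Th) + joint_law mY (event' J Th))%E.
  apply: le_trans (measureU2 _ _ _); [|exact: measurable_event|exact: measurable_event'].
  apply: le_measure; rewrite ?inE.
  - exact: measurable_rect.
  - by apply: measurableU; [exact: measurable_event|exact: measurable_event'].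
  - move=> x h; have [h'|h'] := leP 0 (\sum_(j | j \notin J) a j * tnth x j).
      by left; split.
    by right; split => //; exact: ltW.
move: U; rewrite E R1.
have fe : joint_law mY (event J Th) \is a fin_num.
  apply: (@prob01_fin (jointmap Y @^-1` event J Th)).
  by apply: measurable_preimage_jointmap => //; exact: measurable_event.
rewrite -(fineK fe) -EFinD !lee_fin; lra.
Qed.

Definition wsum (t : R) : R := \sum_j a j * Y j t.

Lemma measurable_wsum : measurable_fun D wsum.
Proof.
by apply: measurable_sum => j; apply: measurable_funM => //; exact: mY.
Qed.

Definition good (n : nat) (tau : R) (J : {set 'I_M}) : bool :=
  (#|J| == n) && (tau < alpha * \sum_(j in J) a j).

(** An index in just one of [J] and [J'] belongs to [Th], so its variable would lie in [ray] for one
    event and in [core] for the other. *)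
Lemma event_disjoint (J J' Th : {set 'I_M}) : J \subset Th -> J' \subset Th ->
  J != J' -> event J Th `&` event J' Th = set0.
Proof.
move=> JT JT' /eqP neJ; rewrite -subset0 => x [[h _] [h' _]]; apply: neJ.
have rc (z : R) : ray z -> core z -> False.
  rewrite /ray /core /= !in_itv/= andbT => h1 /andP[_ h2].
  by have := lt_le_trans h1 h2; rewrite ltxx.
apply/setP => j; apply/idP/idP => jJ; apply/negPn/negP => njJ.
  have := h j; have := h' j; rewrite /cell jJ (negPf njJ) (fintype.subsetP JT j jJ).
  by move=> h1 h2; exact: rc h2 h1.
have := h j; have := h' j; rewrite /cell jJ (negPf njJ) (fintype.subsetP JT' j jJ).
by move=> h1 h2; exact: rc h1 h2.
Qed.

Lemma event_sub (J Th : {set 'I_M}) (tau : R) : tau < alpha * \sum_(j in J) a j ->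
  D `&` jointmap Y @^-1` event J Th `<=` D `&` [set t | tau < `|wsum t|].
Proof.
move=> tJ t [Dt [h1 h2]]; split => //=.
apply: (lt_le_trans _ (ler_norm _)); apply: (lt_le_trans tJ).
have YE j : tnth (jointmap Y t) j = Y j t.
  by rewrite tnth_mktuple indicE mem_set// mulr1.
rewrite mulr_sumr /wsum [leRHS](bigID (mem J))/= -[leLHS]addr0; apply: lerD; last first.
  by move: h2 => /=; under eq_bigr do rewrite YE.
apply: ler_sum => j jJ; rewrite mulrC; apply: ler_wpM2l => //.
by have := h1 j; rewrite /cell jJ YE /ray /= in_itv/= andbT => /ltW.
Qed.

Lemma wsum_lower_fixed (n : nat) (tau : R) (Th : {set 'I_M}) :
  (\sum_(J : {set 'I_M} | good n tau J && (J \subset Th)) (\prod_j cellp J Th j) / 2)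
  <= fine (distr D wsum tau).
Proof.
rewrite -lee_fin fineK; last by apply: distr_unit_fin; exact: measurable_wsum.
pose s := [seq J <- index_enum {set 'I_M} | good n tau J && (J \subset Th)].
rewrite -big_filter -/s -sumEFin.
pose F J := D `&` jointmap Y @^-1` event J Th.
apply: (@le_trans _ _ (\sum_(J <- s) m (F J))%E).
  by apply: lee_sum => J _; exact: joint_law_event.
apply: sum_measure_disjoint_le.
- by rewrite filter_uniq// index_enum_uniq.
- by move=> J; apply: measurable_preimage_jointmap => //; exact: measurable_event.
- apply: measurable_superlevel; [exact: measurable_unit_interval|exact: measurable_wsum].
- move=> J J'; rewrite !mem_filter => /andP[/andP[_ JT] _] /andP[/andP[_ JT'] _] JJ'.
  rewrite /F setIACA -(preimage_setI (jointmap Y)) event_disjoint//.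
  by rewrite preimage_set0 setI0.
- move=> J; rewrite mem_filter => /andP[/andP[/andP[_ gJ] _] _].
  exact: event_sub.
Qed.

(* Averaging over random thinnings [Th] replaces each [tailp j] by [q]. *)
Lemma wsum_lower (n : nat) (tau q : R) : 0 < q -> (forall j, q <= tailp j) ->
  (\sum_(J : {set 'I_M} | good n tau J) (q / 2) ^+ n * (1 - q) ^+ (M - n)) / 2
  <= fine (distr D wsum tau).
Proof.
move=> q0 qp.
have p0 j : 0 < tailp j by exact: lt_le_trans (qp j).
(* Index [j] is kept in [Th] with probability [th j]. For [j] in [J] the average is
   [th j * tailp j / 2 = q / 2]; for [j] outside [J] it is [th j * (1 - tailp j) + (1 - th j) = 1 -
   q]. *)
pose th j := q / tailp j.
have th01 j : 0 <= th j <= 1.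
  by rewrite /th divr_ge0 ?(ltW q0) ?(ltW (p0 j))//= ler_pdivrMr// mul1r.
pose w (Th : {set 'I_M}) := \prod_j (if j \in Th then th j else 1 - th j).
have w0 Th : 0 <= w Th.
  apply: prodr_ge0 => j _; have /andP[h1 h2] := th01 j; case: ifP => _ //.
  by rewrite subr_ge0.
have dE (u v : 'I_M -> R) : \sum_(Th : {set 'I_M}) \prod_j (if j \in Th then u j else v j) =
    \prod_j (u j + v j) by rewrite bigA_distr.
have w1 : \sum_(Th : {set 'I_M}) w Th = 1.
  by rewrite dE big1// => j _; rewrite addrC subrK.
have -> : fine (distr D wsum tau) = \sum_(Th : {set 'I_M}) w Th * fine (distr D wsum tau).
  by rewrite -mulr_suml w1 mul1r.
apply: le_trans (ler_sum _ (fun Th _ => ler_wpM2l (w0 Th) (wsum_lower_fixed n tau Th))).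
rewrite mulr_suml.
under [leRHS]eq_bigr do rewrite mulr_sumr.
rewrite (exchange_big_dep (good n tau))/=; last by move=> Th J _ /andP[].
apply: ler_sum => J gJ; rewrite -(ler_pM2r (ltr0Sn R 1)) divfK//.
rewrite mulr_suml; under [leRHS]eq_bigr do rewrite mulrA divfK//.
(* [Gj] vanishes on [J], so sets [Th] that do not contain [J] contribute nothing and the sum may run
   over all [Th], where it factorizes. *)
pose Fj j := th j * (if j \in J then tailp j / 2 else 1 - tailp j).
pose Gj j := if j \in J then 0 else 1 - th j.
have -> : \sum_(Th : {set 'I_M} | good n tau J && (J \subset Th))
    w Th * \prod_j cellp J Th j =
    \sum_(Th : {set 'I_M}) \prod_j (if j \in Th then Fj j else Gj j).
  rewrite [RHS](bigID (fun Th : {set 'I_M} => J \subset Th))/= [X in _ + X]big1 ?addr0.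
    rewrite gJ /=; apply: eq_bigr => Th JT; rewrite /w -big_split/=.
    apply: eq_bigr => j _; rewrite /cellp /Fj /Gj.
    have [jJ|jJ] := boolP (j \in J); first by rewrite (fintype.subsetP JT).
    by case: ifP => _; rewrite ?mulr1.
  move=> Th /fintype.subsetPn[j jJ jT]; rewrite (bigD1 j)//= (negPf jT) /Gj jJ.
  by rewrite mul0r.
rewrite dE.
have -> : \prod_j (Fj j + Gj j) = \prod_j (if j \in J then q / 2 else 1 - q).
  apply: eq_bigr => j _; rewrite /Fj /Gj /th; have := p0 j => /gt_eqF/negbT pj.
  by case: ifP => _; field.
rewrite (bigID (mem J))/= (eq_bigr (fun=> q / 2)); last by move=> j ->.
rewrite [X in _ <= _ * X](eq_bigr (fun=> 1 - q)); last by move=> j /negPf ->.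
rewrite !prodr_const; case/andP: gJ => /eqP <- _.
have -> : #|(fun i : 'I_M => i \notin J)| = (M - #|J|)%N.
  have /(congr1 (subn^~ #|J|)) := cardC (mem J); rewrite addKn card_ord => <-.
  exact: eq_card.
by [].
Qed.

End SymmetricSums.

(** * Counting index sets *)

Section Counting.
Context {R : realType} (r : nat).
Variables p v : 'I_r -> R.
Hypothesis p0 : forall s, 0 <= p s.

(* [iid_tail n tau] is the probability that the sum of [n] independent
   variables taking the value [v s] with probability [p s] exceeds [tau]. *)
Fixpoint iid_tail (n : nat) (tau : R) : R :=
  if n is n'.+1 then \sum_s p s * iid_tail n' (tau - v s) else (tau < 0)%R%:R.

Lemma iid_tailS n tau : iid_tail n.+1 tau = \sum_s p s * iid_tail n (tau - v s).
Proof. by []. Qed.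

Lemma iid_tail_ge0 n tau : 0 <= iid_tail n tau.
Proof.
by elim: n tau => [|n IH] tau /=; [rewrite ler0n|apply: sumr_ge0 => s _; exact: mulr_ge0].
Qed.

Variables (M : nat) (sigma : 'I_M -> 'I_r).
Let a j := v (sigma j).

Definition admissible (n : nat) (tau : R) (U J : {set 'I_M}) : bool :=
  [&& #|J| == n, J \subset ~: U & tau < \sum_(j in J) a j].

Definition ncount (n : nat) (tau : R) (U : {set 'I_M}) : R :=
  \sum_(J | admissible n tau U J) 1.

(** Double counting of the pairs of a set [J] and an element [j] of it: deleting [j] from [J] and
    forbidding its reuse through [U] leaves a set with one element less. *)
Lemma ncount_rec n tau U :
  n.+1%:R * ncount n.+1 tau U = \sum_(j | j \notin U) ncount n (tau - a j) (j |: U).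
Proof.
rewrite /ncount mulr_sumr.
transitivity (\sum_(J | admissible n.+1 tau U J) \sum_(j in J) (1 : R)).
  apply: eq_bigr => J /and3P[/eqP cJ _ _].
  by rewrite mulr1 sumr_const cJ.
rewrite (exchange_big_dep (fun j => j \notin U))/=; last first.
  by move=> J j /and3P[_ /fintype.subsetP JU _] /JU; rewrite inE.
apply: eq_bigr => j jU.
rewrite (reindex_onto (fun J => j |: J) (fun J => J :\ j))/=; last first.
  by move=> J /andP[_ jJ]; rewrite finset.setD1K.
apply: eq_bigl => J; rewrite /admissible.
have -> : (J \subset ~: (j |: U)) = (j \notin J) && (J \subset ~: U).
  rewrite finset.setCU finset.subsetI; congr (_ && _).
  by rewrite finset.subsetC finset.sub1set inE.
have [jJ|jJ] := boolP (j \in J).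
  rewrite andbF; apply/negbTE; apply/negP => /andP[_ /eqP /finset.setP /(_ j)].
  by rewrite !inE eqxx jJ.
rewrite finset.setU1K// eqxx andbT finset.setU11 andbT cardsU1 jJ add1n eqSS.
by rewrite big_setU1//= ltrBlDl finset.subUset finset.sub1set inE jU.
Qed.

Lemma ncount_ge (n0 n : nat) (K tau : R) (U : {set 'I_M}) : 0 <= K ->
  (forall s (U' : {set 'I_M}), (#|U'| <= n0)%N ->
    K * p s <= #|[pred j | (sigma j == s) && (j \notin U')]|%:R) ->
  (#|U| + n <= n0)%N ->
  K ^+ n * iid_tail n tau <= n`!%:R * ncount n tau U.
Proof.
move=> K0 HK; elim: n tau U => [|n IH] tau U Un.
  rewrite expr0 fact0 !mul1r /= /ncount.
  have [t0|_] := ltP tau 0; last by apply: sumr_ge0.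
  rewrite (bigD1 finset.set0)/= ?lerDl ?sumr_ge0//.
  by rewrite /admissible cards0 eqxx big_set0 t0 andbT/= finset.sub0set.
rewrite factS mulnC natrM -mulrA ncount_rec [leRHS]mulr_sumr.
apply: (@le_trans _ _ (\sum_(j | j \notin U) K ^+ n * iid_tail n (tau - a j))).
  rewrite exprSr -mulrA -mulr_sumr iid_tailS.
  apply: ler_wpM2l; first exact: exprn_ge0.
  rewrite (partition_big sigma predT)//= mulr_sumr; apply: ler_sum => s _.
  rewrite mulrA.
  apply: (@le_trans _ _ (\sum_(j | (j \notin U) && (sigma j == s)) iid_tail n (tau - v s))).
    rewrite sumr_const -mulr_natl; apply: ler_wpM2r; first exact: iid_tail_ge0.
    apply: le_trans (HK s U _) _; first by rewrite (leq_trans _ Un)// leq_addr.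
    by rewrite ler_nat; apply/subset_leq_card/fintype.subsetP => j /andP[sj jU]; rewrite unfold_in /= jU.
  by apply: ler_sum => j /andP[_ /eqP <-].
apply: ler_sum => j jU; apply: IH.
by rewrite cardsU1 jU /= add1n addSn -addnS.
Qed.

End Counting.

(** * Lower tail bound for weighted sums of symmetric variables *)

Section Lower.
Context {R : realType}.
Local Notation m := (@lebesgue_measure R).
Local Notation D := (@unit_interval R).

Lemma card_ord_pred (M : nat) (P : pred nat) :
  #|[pred j : 'I_M | P j]| = count P (iota 0 M).
Proof.
rewrite cardE /enum_mem size_filter -enumT -val_enum_ord count_map.
by apply: eq_count => j.
Qed.

(** Each code is listed [c s] times and the list is padded to length [M] with [s0]. Only the fiber
    of [s0] exceeds its quota, which is harmless later because [s0] codes the value 0. *)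
Lemma fibers_exist (r M : nat) (c : 'I_r -> nat) (s0 : 'I_r) :
  (\sum_s c s <= M)%N -> exists sigma : 'I_M -> 'I_r,
  (forall s, c s <= #|[pred j | sigma j == s]|)%N /\
  (forall s, s != s0 -> #|[pred j | sigma j == s]| = c s).
Proof.
move=> cM; pose L := flatten [seq nseq (c s) s | s <- enum 'I_r].
have sL : size L = (\sum_s c s)%N.
  rewrite /L size_flatten /shape -map_comp sumnE big_map big_enum/=.
  by apply: eq_bigr => s _; rewrite size_nseq.
have cL s : count_mem s L = c s.
  rewrite /L count_flatten -map_comp sumnE big_map big_enum/= (bigD1 s)//=.
  rewrite count_nseq /= eqxx mul1n big1 ?addn0// => s' /negPf ss'.
  by rewrite count_nseq /= ss' mul0n.
pose L' := L ++ nseq (M - size L) s0.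
have sL' : size L' = M by rewrite size_cat size_nseq subnKC// sL.
have E s : #|[pred j : 'I_M | nth s0 L' j == s]| = count_mem s L'.
  rewrite (card_ord_pred M (fun j => nth s0 L' j == s)).
  rewrite -(count_map (nth s0 L') (pred1 s)) map_nth_iota0 ?sL'//.
  by rewrite -{1}sL' take_size.
exists (fun j => nth s0 L' j); split => s.
  by rewrite E count_cat cL leq_addr.
by rewrite E count_cat cL count_nseq eq_sym /= => /negPf ->; rewrite mul0n addn0.
Qed.

Lemma bernoulli_inequality (q : R) (M : nat) : 0 <= q <= 1 ->
  1 - M%:R * q <= (1 - q) ^+ M.
Proof.
move=> /andP[q0 q1]; elim: M => [|M IH]; first by rewrite mul0r subr0 expr0.
rewrite exprS; apply: le_trans (ler_wpM2l _ IH); last by rewrite subr_ge0.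
rewrite -subr_ge0; have -> : (1 - q) * (1 - M%:R * q) - (1 - M.+1%:R * q) = M%:R * q ^+ 2.
  by rewrite -natr1; ring.
by rewrite mulr_ge0// sqr_ge0.
Qed.

Variables (M r : nat) (Y : 'I_M -> R -> R).
Hypothesis mY : forall j, measurable_fun D (Y j).
Hypothesis iY : independent Y.
Hypothesis sY : forall j, symmetrically_distributed (Y j).
Variables (p v : 'I_r -> R) (sigma : 'I_M -> 'I_r).
Hypotheses (p0 : forall s, 0 <= p s) (v0 : forall s, 0 <= v s).

(** The denominator 4 outside the power is made of the factor [1/2] in [wsum_lower] and of
    [(1 - q)^(M - n) >= 1/2], which is the Bernoulli inequality with [M q <= 1/2]. Inside the power,
    [q / 2] meets [M / 2]: by the assumption on [p], rounding and the exclusion of [n0] indices lose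
    at most half of the [M p_s] indices. *)
Lemma wsum_tail_ge (alpha q kappa : R) (n0 n : nat) (tau : R) :
  0 < alpha -> 0 < q -> (forall j, q <= tailp Y alpha j) ->
  M%:R * q <= 2^-1 -> 0 <= kappa -> kappa <= M%:R * q -> (0 < M)%N ->
  (forall s, p s = 0 \/ 2 * n0.+1%:R <= M%:R * p s) ->
  (forall s, M%:R * p s - 1 <= #|[pred j | sigma j == s]|%:R) ->
  (n <= n0)%N -> (n <= M)%N ->
  (kappa / 4) ^+ n / n`!%:R * iid_tail p v n tau / 4 <=
  fine (distr D (wsum Y (fun j => v (sigma j))) (alpha * tau)).
Proof.
move=> al0 q0 qp Mq k0 kMq M0 psmall fib nn0 nM.
have a0 j : 0 <= v (sigma j) by exact: v0.
apply: le_trans (@wsum_lower _ _ _ mY iY sY _ al0 _ a0 n (alpha * tau) q q0 qp).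
have q1 : 0 <= q <= 1.
  rewrite (ltW q0)/=; apply: (@le_trans _ _ (M%:R * q)); last by lra.
  by rewrite ler_peMl ?(ltW q0)// ler1n.
have h1 : 2^-1 <= (1 - q) ^+ (M - n).
  apply: (@le_trans _ _ ((1 - q) ^+ M)).
    by apply: le_trans (bernoulli_inequality M q1); lra.
  by apply: ler_wiXn2l; [lra|lra|exact: leq_subr].
have -> : \sum_(J | good alpha (fun j => v (sigma j)) n (alpha * tau) J)
    (q / 2) ^+ n * (1 - q) ^+ (M - n) =
    (q / 2) ^+ n * (1 - q) ^+ (M - n) * ncount v sigma n tau finset.set0.
  rewrite /ncount mulr_sumr; apply: eq_big => J; last by rewrite mulr1.
  rewrite /good /admissible ltr_pM2l//.
  by rewrite finset.setC0 finset.subsetT.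
have HK s (U : {set 'I_M}) : (#|U| <= n0)%N ->
    M%:R / 2 * p s <= #|[pred j | (sigma j == s) && (j \notin U)]|%:R.
  move=> Un; have [->|ps] := psmall s; first by rewrite mulr0.
  have cardU : (#|[pred j | sigma j == s]| <=
      #|[pred j | (sigma j == s) && (j \notin U)]| + #|U|)%N.
    rewrite -(cardID (mem U) [pred j | sigma j == s]) addnC leq_add//.
      by apply/subset_leq_card/fintype.subsetP => j; rewrite !inE => /andP[-> ->].
    by apply/subset_leq_card/fintype.subsetP => j; rewrite !inE => /andP[].
  have := fib s; move: cardU; rewrite -(ler_nat R) natrD => cardU.
  have : #|U|%:R <= n0%:R :> R by rewrite ler_nat.
  by move: ps; rewrite -[n0.+1%:R]natr1; lra.
have KK : 0 <= M%:R / 2 :> R by rewrite divr_ge0.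
have cU0 : (#|(finset.set0 : {set 'I_M})| + n <= n0)%N by rewrite cards0.
have h2 := ncount_ge v p0 tau KK HK cU0.
have nf : 0 < n`!%:R :> R by rewrite ltr0n fact_gt0.
have h3 : (M%:R / 2) ^+ n * iid_tail p v n tau / n`!%:R <= ncount v sigma n tau finset.set0.
  by rewrite ler_pdivrMr// [leRHS]mulrC.
have iid0 := iid_tail_ge0 v p0 n tau.
have nc0 : 0 <= ncount v sigma n tau finset.set0 by apply: sumr_ge0.
rewrite ler_pdivlMr//.
apply: (@le_trans _ _ ((q / 2) ^+ n / 2 * ncount v sigma n tau finset.set0)); last first.
  by apply: ler_wpM2r => //; apply: ler_wpM2l => //; rewrite exprn_ge0// divr_ge0// ltW.
have qn0 : 0 <= (q / 2) ^+ n / 2 by rewrite divr_ge0// exprn_ge0// divr_ge0// ltW.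
apply: le_trans (ler_wpM2l qn0 h3).
have -> : (q / 2) ^+ n / 2 * ((M%:R / 2) ^+ n * iid_tail p v n tau / n`!%:R) =
    (M%:R * q / 4) ^+ n * (iid_tail p v n tau / n`!%:R / 2).
  rewrite (_ : M%:R * q / 4 = (q / 2) * (M%:R / 2)); last by field.
  by rewrite [in RHS]exprMn_comm; [ring|exact: mulrC].
have -> : (kappa / 4) ^+ n / n`!%:R * iid_tail p v n tau / 4 * 2 =
    (kappa / 4) ^+ n * (iid_tail p v n tau / n`!%:R / 2).
  by field; rewrite gt_eqF.
apply: ler_wpM2r; first by rewrite divr_ge0// divr_ge0// ltW.
apply: lerXn2r; rewrite ?nnegrE.
- by rewrite divr_ge0.
- by rewrite divr_ge0// mulr_ge0// ltW.
- by rewrite ler_pM2r.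
Qed.

End Lower.

(** * Upper bounds for compound Poisson sums *)

Section Upper.
Context {R : realType}.
Local Notation m := (@lebesgue_measure R).
Local Notation D := (@unit_interval R).

Lemma le_measure_cover (I : choiceType) (s : seq I) (F : I -> set R) (X : set R) :
  (forall i, measurable (F i)) -> measurable X ->
  (forall t, X t -> exists2 i, i \in s & F i t) ->
  (m X <= \sum_(i <- s) m (F i))%E.
Proof.
move=> mF mX cov.
have mU (r : seq I) : measurable (\big[setU/set0]_(i <- r) F i).
  by apply: big_ind => // *; exact: measurableU.
apply: (@le_trans _ _ (m (\big[setU/set0]_(i <- s) F i))).
  apply: le_measure; rewrite ?inE//; first exact: mU.
  by move=> t /cov[i si Fi]; rewrite -bigcup_seq; exists i.
elim: s {cov} => [|i s IH]; first by rewrite !big_nil measure0.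
rewrite !big_cons; apply: le_trans (leeD2l _ IH).
by apply: measureU2; [exact: mF|exact: mU].
Qed.

Variables (r : nat) (p v : 'I_r -> R).
Variables (I : choiceType) (X : I -> R -> 'I_r) (E : set R) (e : R).
Hypothesis mE : measurable E.
Hypothesis mX : forall i k, measurable (D `&` [set t | X i t = k]).
Hypothesis mvX : forall i, measurable_fun D (fun t => v (X i t)).

Definition pattern (w : I -> 'I_r) (s : seq I) : set R :=
  [set t | forall i, i \in s -> X i t = w i].

Definition above (s : seq I) (tau : R) : set R :=
  [set t | tau < \sum_(i <- s) v (X i t)].

Hypothesis XE : forall (s : seq I) (w : I -> 'I_r), uniq s ->
  (m (D `&` E `&` pattern w s) <= (e * \prod_(i <- s) p (w i))%:E)%E.

Lemma measurable_pattern w s : measurable (D `&` pattern w s).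
Proof.
elim: s => [|i s IH].
  by rewrite (_ : pattern _ _ = setT) ?setIT; [exact: measurable_unit_interval|apply/seteqP].
rewrite (_ : D `&` _ = (D `&` [set t | X i t = w i]) `&` (D `&` pattern w s)).
  exact: measurableI.
apply/seteqP; split => t /=.
  move=> [Dt h]; split; split => //; first by apply: h; rewrite mem_head.
  by move=> j js; apply: h; rewrite inE js orbT.
by move=> [[Dt h] [_ h']]; split => // j; rewrite inE => /orP[/eqP ->//|/h'].
Qed.

Lemma measurable_sum_superlevel (s : seq I) (tau : R) :
  measurable (D `&` above s tau).
Proof.
have mS : measurable_fun D (fun t => \sum_(i <- s) v (X i t)) by exact: measurable_sum.
have := mS measurable_unit_interval _ (measurable_itv `]tau, +oo[).
by congr measurable; apply/seteqP; split => t [Dt]; rewrite /above /= in_itv/= andbT => h; split.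
Qed.

(** Induction on the list [s] of indices whose values are still free, those of [s'] being prescribed
    by [w]. Splitting according to the value at the first free index moves it from [s] to [s']. *)
Lemma iid_tail_upper_aux (s s' : seq I) (w : I -> 'I_r) (tau : R) : uniq (s ++ s') ->
  (m (D `&` E `&` pattern w s' `&` above s tau) <=
   (e * (\prod_(i <- s') p (w i)) * iid_tail p v (size s) tau)%:E)%E.
Proof.
have mEv s1 s2 w1 tau1 : measurable
    (D `&` E `&` pattern w1 s1 `&` above s2 tau1).
  have set4 (A B C F : set R) : A `&` B `&` C `&` F = A `&` C `&` B `&` (A `&` F).
    by apply/seteqP; split => t; rewrite /setI/=; tauto.
  rewrite set4; apply: measurableI; last exact: measurable_sum_superlevel.
  by apply: measurableI => //; exact: measurable_pattern.
elim: s s' w tau => [|i s IH] s' w tau /=.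
  move=> us'; have [t0|t0] := ltP tau 0.
    rewrite mulr1; apply: le_trans (XE w us'); apply: le_measure; rewrite ?inE.
    - exact: mEv.
    - rewrite setIAC; apply: measurableI => //; exact: measurable_pattern.
    - exact: subIsetl.
  rewrite (_ : _ `&` _ = set0) ?measure0 ?mulr0//.
  by rewrite -subset0 => t [_]; rewrite /above /= big_nil ltNge t0.
move=> /andP[]; rewrite mem_cat negb_or => /andP[is_ is'] us.
have us2 : uniq (s ++ i :: s').
  move: us; rewrite !cat_uniq /= => /and3P[-> + ->].
  by rewrite negb_or is_ is' /= => ->.
pose w' k j := if j == i then k else w j.
have step := fun k => IH (i :: s') (w' k) (tau - v k) us2.
apply: le_trans (le_measure_cover (s := enum 'I_r) (F := fun k =>
  D `&` E `&` pattern (w' k) (i :: s') `&` above s (tau - v k)) _ _ _) _.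
- by move=> k; exact: mEv.
- exact: mEv.
- move=> t [[DEt pt]]; rewrite /above /= big_cons => ht; exists (X i t); first by rewrite mem_enum.
  split; last by rewrite /above /= ltrBlDl.
  split => // j; rewrite inE /w' => /orP[/eqP ->|js']; first by rewrite eqxx.
  by case: eqP => [->//|_]; exact: pt.
apply: (le_trans (lee_sum _ (fun k _ => step k))).
rewrite sumEFin lee_fin big_enum/= mulr_sumr; apply: ler_sum => k _.
rewrite big_cons {1}/w' eqxx.
rewrite (_ : \prod_(j <- s') p (w' k j) = \prod_(j <- s') p (w j)).
  by rewrite le_eqVlt; apply/orP; left; apply/eqP; ring.
rewrite big_seq [RHS]big_seq; apply: eq_bigr => j js'.
by rewrite /w'; case: eqP => // ji; move: is'; rewrite -ji js'.
Qed.

Lemma iid_tail_upper (s : seq I) (tau : R) : uniq s ->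
  (m (D `&` E `&` above s tau) <=
   (e * iid_tail p v (size s) tau)%:E)%E.
Proof.
case: (pselect (exists w : I -> 'I_r, True)) => [[w _]|nw] us.
  have := @iid_tail_upper_aux s [::] w tau; rewrite cats0 big_nil mulr1.
  rewrite (_ : pattern w [::] = setT) ?setIT; first exact.
  by apply/seteqP.
by exfalso; apply: nw; exists (fun i => X i 0).
Qed.

End Upper.

Section KruglovTail.
Context {R : realType}.
Local Notation m := (@lebesgue_measure R).
Local Notation D := (@unit_interval R).

Lemma exp_partial_sum_le (x : R) (n : nat) : 0 <= x ->
  \sum_(i < n) x ^+ i / i`!%:R <= expR x.
Proof.
move=> x0; have nd : {homo series (exp_coeff x) : k l / (k <= l)%N >-> k <= l}.
  by apply: nondecreasing_series => i _ _; exact: exp_coeff_ge0.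
have := nondecreasing_cvgn_le nd (is_cvg_series_exp_coeff x) n.
by rewrite /series /= big_mkord.
Qed.

Lemma sum_half (g : nat -> R) (j : nat) :
  \sum_(i < j.*2) g i./2 = 2 * \sum_(i < j) g i.
Proof.
elim: j => [|j IH]; first by rewrite !big_ord0 mulr0.
rewrite doubleS !big_ord_recr /= IH doubleK uphalf_double.
by ring.
Qed.

(** The quotient of the two sides is a binomial coefficient. *)
Lemma fact_uphalf_le (n : nat) : ((uphalf n)`! * (n./2)`! <= n`!)%N.
Proof.
have hn : (uphalf n <= n)%N by rewrite leq_uphalf_double -addnn leq_addr.
have <- := bin_fact hn; rewrite (_ : n - uphalf n = n./2)%N.
  by rewrite leq_pmull// bin_gt0.
by rewrite -[X in (X - _)%N]odd_double_half uphalf_half -addnn addnA addKn.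
Qed.

Lemma subn_lt_uphalf (n i : nat) : (i < n)%N -> (uphalf n <= i)%N ->
  (n - i.+1 < uphalf n)%N.
Proof.
have := odd_double_half n; rewrite uphalf_half -addnn.
by case: (odd n) => /=; lia.
Qed.

(* The terms are [2 / n!] from [iid_tail_halving] times the inverse of the
   constant of [wsum_tail_ge]. *)
Lemma kruglov_constant (th : R) : 0 < th -> exists c : nat, (0 < c)%N /\
  forall P, \sum_(1 <= n < P.+1) 8 * ((uphalf n)`!%:R / n`!%:R / th ^+ uphalf n) <= c%:R.
Proof.
move=> th0; pose b := 1 + th^-1.
have ti0 : 0 < th^-1 by rewrite invr_gt0.
have b1 : 1 <= b by rewrite /b lerDl ltW.
have b0 : 0 <= b by exact: le_trans b1.
pose C := 16 * b * expR b.
have C0 : 0 <= C by rewrite /C !mulr_ge0// expR_ge0.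
exists (Num.truncn C).+1; split => // P.
apply: (@le_trans _ _ C); last by rewrite ltW// truncnS_gt.
apply: (@le_trans _ _ (\sum_(n < P.+1.*2) 8 * b * (b ^+ n./2 / (n./2)`!%:R))); last first.
  rewrite -mulr_sumr (sum_half (fun i => b ^+ i / i`!%:R)).
  have := exp_partial_sum_le P.+1 b0; rewrite /C.
  have : 0 <= 16 * b by rewrite mulr_ge0.
  move=> h1 h2; have := ler_wpM2l h1 h2.
  by congr (_ <= _); ring.
have term n : 8 * ((uphalf n)`!%:R / n`!%:R / th ^+ uphalf n) <=
    8 * b * (b ^+ n./2 / (n./2)`!%:R).
  rewrite -[leRHS]mulrA; apply: ler_wpM2l => //; rewrite [leRHS]mulrA [leRHS]mulrC.
  have fpos k : 0 < k`!%:R :> R by rewrite ltr0n fact_gt0.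
  have h2 : (uphalf n)`!%:R / n`!%:R <= (n./2)`!%:R^-1 :> R.
    rewrite ler_pdivrMr// mulrC ler_pdivlMr// -natrM ler_nat.
    exact: fact_uphalf_le.
  have h3 : (th ^+ uphalf n)^-1 <= b * b ^+ n./2.
    rewrite -exprVn -exprS; apply: (@le_trans _ _ (b ^+ uphalf n)).
      by apply: lerXn2r; rewrite ?nnegrE ?(ltW ti0)// /b lerDr.
    apply: ler_weXn2l => //.
    by rewrite uphalf_half -add1n leq_add2r; case: (odd n).
  have h4 : 0 <= (th ^+ uphalf n)^-1 by rewrite invr_ge0 exprn_ge0// ltW.
  by apply: ler_pM => //; rewrite divr_ge0// ltW.
apply: (@le_trans _ _ (\sum_(n < P.+1) 8 * b * (b ^+ n./2 / (n./2)`!%:R))).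
  rewrite -(big_mkord predT (fun n => 8 * b * (b ^+ n./2 / (n./2)`!%:R))).
  rewrite [leRHS]big_ltn//; apply: ler_wpDl; last by apply: ler_sum => n _; exact: term.
  by rewrite !mulr_ge0 ?invr_ge0 ?exprn_ge0.
rewrite -(big_mkord predT (fun n => 8 * b * (b ^+ n./2 / (n./2)`!%:R))).
rewrite -(big_mkord predT (fun n => 8 * b * (b ^+ n./2 / (n./2)`!%:R))).
rewrite [leRHS](big_cat_nat (n := P.+1))//=; last by rewrite -addnn leq_addr.
rewrite lerDl; apply: sumr_ge0 => n _.
by rewrite !mulr_ge0 ?invr_ge0 ?exprn_ge0.
Qed.

Variables (r : nat) (p v : 'I_r -> R).
Hypotheses (p0 : forall s, 0 <= p s) (v0 : forall s, 0 <= v s).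
Variable E : nat -> set R.
Hypothesis mE : forall n, (0 < n)%N -> measurable (E n).
Hypothesis E_disj : trivIset [set n | (0 < n)%N] E.
Variable X : forall n, 'I_n -> R -> 'I_r.
Hypothesis mX : forall n (i : 'I_n) k, measurable (D `&` [set t | X i t = k]).
Hypothesis mvX : forall n (i : 'I_n), measurable_fun D (fun t => v (X i t)).
Hypothesis XE : forall n (s : seq 'I_n) (w : 'I_n -> 'I_r), (0 < n)%N -> uniq s ->
  (m (D `&` E n `&` pattern (@X n) w s) <=
   ((expR 1 * (n`!)%:R)^-1 * \prod_(i <- s) p (w i))%:E)%E.

Definition kruglov_sum (P : nat) (t : R) : R :=
  \sum_(1 <= n < P.+1) \sum_(i < n) v (X i t) * \1_(E n) t.

Lemma measurable_kruglov_sum P : measurable_fun D (kruglov_sum P).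
Proof.
rewrite /kruglov_sum; under eq_fun do rewrite big_nat.
(* The set [E 0] is not assumed measurable, so the summand at 0 is replaced by the zero function. *)
apply: (eq_measurable_fun (fun t => \sum_(n <- index_iota 1 P.+1)
   (if (0 < n)%N then \sum_(i < n) v (X i t) * \1_(E n) t else 0))).
  move=> t _; rewrite -[RHS]big_nat !big_nat.
  by apply: eq_bigr => n /andP[-> _].
apply: measurable_sum => -[|n] //=.
apply: measurable_sum => i; apply: measurable_funM; first exact: mvX.
by apply: measurable_indic; exact: mE.
Qed.

Lemma kruglov_sumE P n t : (0 < n <= P)%N -> E n t ->
  kruglov_sum P t = \sum_(i < n) v (X i t).
Proof.
move=> /andP[n0 nP] Et; rewrite /kruglov_sum (bigD1_seq n)/= ?iota_uniq//; last first.
  by rewrite mem_index_iota n0 ltnS.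
rewrite [X in _ + X]big1_seq ?addr0; last first.
  move=> k /andP[kn]; rewrite mem_index_iota => /andP[k0 _].
  rewrite big1// => i _; rewrite indicE memNset ?mulr0// => Ek.
  by move/eqP: kn; apply; apply: (E_disj (i := k) (j := n)) => //; exists t.
by apply: eq_bigr => i _; rewrite indicE mem_set// mulr1.
Qed.

(* One of the two halves of the sum exceeds [tau / 2].  Halving the number of
   summands makes [1 / n!] small enough to absorb the factor [theta ^ (n / 2)]
   lost in the lower bound for the sums of the [y_i]. *)
Lemma iid_tail_halving n (tau : R) : (0 < n)%N ->
  (m (D `&` E n `&` [set t | (tau < \sum_(i < n) v (X i t))%R]) <=
   (2 * (n`!%:R)^-1 * iid_tail p v (uphalf n) (tau / 2))%:E)%E.
Proof.
move=> n0; have hn : (uphalf n <= n)%N by rewrite leq_uphalf_double -addnn leq_addr.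
(* The first and the last [uphalf n] indices. For odd [n] they share the middle one, which is
   harmless because [v] is nonnegative. *)
pose s1 := [seq widen_ord hn j | j <- enum 'I_(uphalf n)].
pose s2 := [seq rev_ord (widen_ord hn j) | j <- enum 'I_(uphalf n)].
have wi : injective (widen_ord hn) by move=> i j [h]; exact: val_inj.
have u1 : uniq s1 by rewrite map_inj_uniq ?enum_uniq.
have u2 : uniq s2.
  by rewrite map_inj_uniq ?enum_uniq// => i j /rev_ord_inj; exact: wi.
have z1 : size s1 = uphalf n by rewrite size_map size_enum_ord.
have z2 : size s2 = uphalf n by rewrite size_map size_enum_ord.
have e0 : ((expR 1 * (n`!)%:R)^-1 <= (n`!%:R)^-1 :> R).
  have h1 : 1 <= expR 1 :> R by apply: le_trans (expR_ge1Dx 1); rewrite lerDl.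
  have h2 : 0 < n`!%:R :> R by rewrite ltr0n fact_gt0.
  rewrite lef_pV2 ?posrE// ?mulr_gt0 ?expR_gt0//.
  by rewrite ler_peMl// ltW.
have iid0 := iid_tail_ge0 v p0 (uphalf n) (tau / 2).
have b1 := iid_tail_upper (mE n0) (@mX n) (@mvX n) (fun s w => XE w n0) (tau / 2) u1.
have b2 := iid_tail_upper (mE n0) (@mX n) (@mvX n) (fun s w => XE w n0) (tau / 2) u2.
have mA (s : seq 'I_n) (tau' : R) : measurable (D `&` E n `&` above v (@X n) s tau').
  rewrite setIAC; apply: measurableI; last exact: mE.
  exact: (measurable_sum_superlevel (@mvX n)).
rewrite z1 in b1; rewrite z2 in b2.
apply: (@le_trans _ _ (m (D `&` E n `&` above v (@X n) s1 (tau / 2)) +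
   m (D `&` E n `&` above v (@X n) s2 (tau / 2)))%E); last first.
  apply: le_trans (leeD b1 b2) _; rewrite -EFinD lee_fin.
  have := ler_wpM2r iid0 e0; lra.
apply: le_trans (measureU2 _ _ _); [|exact: mA|exact: mA].
apply: le_measure; rewrite ?inE.
- have := mA (index_enum 'I_n) tau; exact.
- by apply: measurableU; exact: mA.
- move=> t [DE /= ht].
  have hs : \sum_(i < n) v (X i t) <= \sum_(i <- s1) v (X i t) + \sum_(i <- s2) v (X i t).
    rewrite (bigID (mem s1))/= -big_uniq//; apply: lerD => //.
    rewrite [leRHS]big_uniq//= [leRHS](bigID (mem s1))/=.
    rewrite -[leLHS]add0r; apply: lerD; first by apply: sumr_ge0.
    rewrite le_eqVlt; apply/orP; left; apply/eqP; apply: eq_bigl => i.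
    have [is1|is1] := boolP (i \in s1); first by rewrite andbF.
    rewrite /= andbT; apply/esym/mapP.
    have im : (uphalf n <= i)%N.
      rewrite leqNgt; apply: contra is1 => ilt; apply/mapP.
      by exists (Ordinal ilt); rewrite ?mem_enum//; exact: val_inj.
    have jlt : (n - i.+1 < uphalf n)%N.
      exact: subn_lt_uphalf.
    exists (Ordinal jlt); rewrite ?mem_enum//; apply: val_inj => /=.
    by rewrite subnSK// subKn// ltnW.
  have [h|h] := ltP (tau / 2) (\sum_(i <- s1) v (X i t)); first by left.
  by right; split => //; rewrite /above /=; lra.
Qed.

Lemma kruglov_sum_tail P (tau : R) : 0 < tau -> (distr D (kruglov_sum P) tau <=
  (\sum_(1 <= n < P.+1) 2 * (n`!%:R)^-1 * iid_tail p v (uphalf n) (tau / 2))%:E)%E.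
Proof.
move=> tau0; rewrite -sumEFin.
pose F n := if (0 < n)%N then D `&` E n `&` [set t | tau < \sum_(i < n) v (X i t)] else set0.
have mF n : measurable (F n).
  rewrite /F; case: ifP => // n0; rewrite setIAC; apply: measurableI; last exact: mE.
  exact: (measurable_sum_superlevel (@mvX n) (index_enum 'I_n)).
apply: le_trans (le_measure_cover (s := index_iota 1 P.+1) mF _ _) _.
- apply: measurable_superlevel; first exact: measurable_unit_interval.
  exact: measurable_kruglov_sum.
- move=> t [Dt /= ht].
  have [[n [n0 nP En]]|none] := pselect (exists n, [/\ (0 < n)%N, (n <= P)%N & E n t]).
    exists n; first by rewrite mem_index_iota n0 ltnS.
    rewrite /F n0; split; first by split.
    rewrite /=; move: ht; rewrite (kruglov_sumE _ En) ?n0//.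
    by rewrite ger0_norm ?sumr_ge0.
  exfalso; move: ht; rewrite /kruglov_sum big1_seq ?normr0 ?ltNge ?ltW// => n.
  rewrite mem_index_iota ltnS => /andP[_ /andP[n0 nP]]; rewrite big1// => i _.
  by rewrite indicE memNset ?mulr0// => En; apply: none; exists n.
- rewrite big_seq [leRHS]big_seq; apply: lee_sum => n.
  rewrite mem_index_iota => /andP[n0 _]; rewrite /F n0.
  exact: iid_tail_halving.
Qed.

End KruglovTail.

(** * The blocks y_i *)

(* [v \o X0] plays the role of a simple function [f], the functions [v \o X n i]
   those of its copies; [s0] is the code of the value [0]. *)
Definition kruglov_sum_bounded {R : realType} (N : (R -> R) -> \bar R) (C : R) : Prop :=
  forall (r P : nat) (v : 'I_r -> R) (s0 : 'I_r) (X0 : R -> 'I_r) (E : nat -> set R)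
    (X : forall n, 'I_n -> R -> 'I_r),
  (forall s, 0 <= v s) -> v s0 = 0 ->
  (forall s, measurable (unit_interval `&` [set t | X0 t = s])) ->
  in_space unit_interval N (fun t => v (X0 t)) ->
  (forall n, (0 < n)%N -> measurable (E n)) ->
  trivIset [set n | (0 < n)%N] E ->
  (forall n (i : 'I_n) s, measurable (unit_interval `&` [set t | X n i t = s])) ->
  (forall n (i : 'I_n), measurable_fun unit_interval (fun t => v (X n i t))) ->
  (forall n (s : seq 'I_n) (w : 'I_n -> 'I_r), (0 < n)%N -> uniq s ->
    (lebesgue_measure (unit_interval `&` E n `&` pattern (X n) w s) <=
     ((expR 1 * (n`!)%:R)^-1 * \prod_(i <- s) pr [set t | X0 t = w i])%:E)%E) ->
  in_space unit_interval N (kruglov_sum v E X P) /\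
  (N (kruglov_sum v E X P) <= C%:E * N (fun t => v (X0 t)))%E.

Section Main.
Variable R : realType.
Local Notation m := (@lebesgue_measure R).
Local Notation D := (@unit_interval R).
Local Notation H := (@half_line R).
Variable A : nat -> set R.
Hypothesis A_meas : forall n, measurable (A n).
Hypothesis A_sub : forall n, A n `<=` H.
Hypothesis A_disj : trivIset [set: nat] A.
Variable S : nat -> nat -> set nat.
Hypothesis S_disj : trivIset [set il : nat * nat | (0 < il.2)%N] (fun il => S il.1 il.2).
Hypothesis S_sum : forall i l : nat, (0 < l)%N ->
  (\esum_(n in S i l) m (A n) = (l%:R^-1)%:E)%E.
Variable N : (R -> R) -> \bar R.
Hypothesis E_ri : ri_space01 N.
Variable T : (R -> R) -> R -> R.
Hypothesis T_emb : isomorphic_embedding (U_space N A) (Z_norm N) D N T.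
Variable l : nat -> nat.
Hypothesis l_pos : forall k, (0 < l k)%N.
Hypothesis B_in_U : forall k i, U_space N A \1_(\bigcup_(n in S i (l k)) A n).
Variable y : nat * nat -> R -> R.
Hypothesis y_def : forall k i, y (k, i) = T \1_(\bigcup_(n in S i (l k)) A n).
Hypothesis y_indep : independent y.
Hypothesis y_sym : forall k i, symmetrically_distributed (y (k, i)).
Variables alpha beta gamma : R.
Hypotheses (alpha_pos : 0 < alpha) (beta_pos : 0 < beta) (gamma_pos : 0 < gamma).
Variable F : nat -> {fset nat}.
Hypothesis F_card : forall k,
  gamma * (l k)%:R <= (#|` F k|%fset)%:R /\ (#|` F k| <= l k)%N.
Hypothesis y_large : forall k i, i \in F k ->
  ((beta / (l k)%:R)%:E <= prob01 [set t | alpha < `|y (k, i) t|]%R)%E.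

Lemma measurable_y k i : measurable_fun D (y (k, i)).
Proof. by rewrite y_def; have [/(_ _ (B_in_U k i))[]] := T_emb. Qed.

Lemma l_pos_real k : 0 < (l k)%:R :> R.
Proof. by rewrite ltr0n. Qed.

Lemma F_nonempty k : exists i, i \in F k.
Proof.
have [h _] := F_card k; apply/fset0Pn; apply: contraTneq h => ->.
by rewrite cardfs0 -ltNge mulr_gt0// l_pos_real.
Qed.

Lemma S_disjoint k i j : i <> j -> S i (l k) `&` S j (l k) = set0.
Proof.
move=> ij; rewrite -subset0 => n h; apply: ij.
have := @S_disj (i, l k) (j, l k) (l_pos k) (l_pos k).
by move=> h'; have [] : (i, l k) = (j, l k) by apply: h'; exists n.
Qed.

Lemma lebesgue_block k i : m (\bigcup_(n in S i (l k)) A n) = ((l k)%:R^-1)%:E.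
Proof. by rewrite lebesgue_B// S_sum. Qed.

(* If [l k = l k'] then [y (k, i)] is independent of itself, hence constant;
   being symmetric it vanishes. *)
Lemma l_injective : injective l.
Proof.
move=> k k' lkk'; apply/eqP/negPn/negP => /eqP nkk'.
have [i Fi] := F_nonempty k.
have E : y (k, i) = y (k', i) by rewrite !y_def lkk'.
have mray : measurable (`]alpha, +oo[%classic : set R) by exact: measurable_itv.
pose Y0 (j : 'I_1) := y (k, i).
have mY0 j : measurable_fun D (Y0 j) by exact: measurable_y.
have sY0 j : symmetrically_distributed (Y0 j) by exact: y_sym.
have pE := prob01_ray mY0 sY0 alpha_pos ord0.
pose q := tailp Y0 alpha ord0.
have q1 : q <= 1 by exact: tailp_le1.
have q0 : 0 < q.
  apply: (@lt_le_trans _ _ (beta / (l k)%:R)); first by rewrite divr_gt0// l_pos_real.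
  rewrite -lee_fin /q /tailp /pr fineK; first exact: y_large.
  apply: prob01_fin; apply: measurable_superlevel; first exact: measurable_unit_interval.
  exact: measurable_y.
have us : uniq [:: (k, i); (k', i)].
  by rewrite /= andbT inE; apply/eqP => -[].
(* With [q / 2] the probability that [y (k, i) > alpha], independence gives [q / 2 = (q / 2)^2],
   impossible for [0 < q <= 1]. *)
have := y_indep (B := fun=> `]alpha, +oo[%classic) us (fun=> mray).
rewrite !big_cons big_nil mule1 -E.
rewrite (_ : \bigcap_(j in _) _ = y (k, i) @^-1` `]alpha, +oo[).
  rewrite pE -EFinM => -[]; rewrite -/q => h.
  have : q / 2 * (1 - q / 2) = 0 by rewrite mulrBr mulr1 -h subrr.
  by move/eqP; rewrite mulf_eq0 => /orP[/eqP|/eqP]; lra.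
apply/seteqP; split => t h.
  by apply: (h (k, i)); rewrite /= mem_head.
move=> [a b]; rewrite /= !inE => /orP[/eqP[-> ->]//|/eqP[-> ->]].
by rewrite -E.
Qed.

(** Pigeonhole on the injective sequence [l]. This lets a single block be taken as large as a given
    simple function and truncation demand. *)
Lemma l_unbounded (L : R) : exists k, L <= (l k)%:R.
Proof.
have [//|none] := pselect (exists k, L <= (l k)%:R); exfalso.
have bnd k : (l k < (Num.truncn L).+1)%N.
  rewrite ltnNge; apply/negP => h; apply: none; exists k.
  apply: ltW; apply: (lt_le_trans (truncnS_gt L)).
  by rewrite ler_nat.
pose n := (Num.truncn L).+1.
pose g (k : 'I_n.+1) : 'I_n := Ordinal (bnd k).
have gi : injective g by move=> a b [/l_injective h]; exact: val_inj.
by have := leq_card g gi; rewrite !card_ord ltnn.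
Qed.

Section Block.
Variables (k M : nat).
Hypothesis MF : (M <= #|` F k|)%N.

Definition idx (j : 'I_M) : nat := nth 0%N (enum_fset (F k)) j.

Lemma idx_in j : idx j \in F k.
Proof. by rewrite /idx; apply: mem_nth; exact: leq_trans (ltn_ord j) MF. Qed.

Lemma idx_inj : injective idx.
Proof.
move=> i j /eqP; rewrite nth_uniq ?fset_uniq//.
- by move/eqP => h; exact: val_inj.
- exact: leq_trans (ltn_ord i) MF.
- exact: leq_trans (ltn_ord j) MF.
Qed.

Definition blockY (j : 'I_M) : R -> R := y (k, idx j).

Lemma blockY_measurable j : measurable_fun D (blockY j).
Proof. exact: measurable_y. Qed.

Lemma blockY_symmetric j : symmetrically_distributed (blockY j).
Proof. exact: y_sym. Qed.

Lemma blockY_independent : independent blockY.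
Proof.
move=> s B us mB.
pose f (j : 'I_M) := (k, idx j).
have fi : injective f by move=> i j [/idx_inj].
pose B' (ki : nat * nat) := if [pick j : 'I_M | f j == ki] is Some j then B j else setT.
have B'E j : B' (f j) = B j.
  rewrite /B'; case: pickP => [j' /eqP/fi -> //|/(_ j)].
  by rewrite eqxx.
have := y_indep (s := map f s) (B := B').
rewrite map_inj_uniq// => /(_ us).
have mB' ki : measurable (B' ki) by rewrite /B'; case: pickP.
move=> /(_ mB'); rewrite big_map.
under [in RHS]eq_bigr do rewrite B'E.
move=> <-; congr prob01; apply/seteqP; split => t h.
  by move=> ki /mapP[j js ->]; rewrite /= B'E; exact: h.
by move=> j js; have := h (f j); rewrite /= B'E; apply; exact: map_f.
Qed.

Lemma blockY_tail j : beta / (l k)%:R <= tailp blockY alpha j.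
Proof.
rewrite -lee_fin /tailp /pr fineK; first by apply: y_large; exact: idx_in.
apply: prob01_fin; apply: measurable_superlevel; first exact: measurable_unit_interval.
exact: blockY_measurable.
Qed.

Lemma Ml : M%:R <= (l k)%:R :> R.
Proof. by rewrite ler_nat (leq_trans MF)//; have [] := F_card k. Qed.

Variable a : 'I_M -> R.
Hypothesis a0 : forall j, 0 <= a j.

Definition blockB (j : 'I_M) : set R := \bigcup_(n in S (idx j) (l k)) A n.

Definition blockh (t : R) : R := \sum_(j <- index_enum 'I_M) a j * \1_(blockB j) t.

Lemma measurable_blockB j : measurable (blockB j).
Proof. exact: measurable_B. Qed.

Lemma measurable_blockh : measurable_fun setT blockh.
Proof. exact: measurable_lincomb measurable_blockB. Qed.

Lemma sum_blockB : (\sum_(j <- index_enum 'I_M) m (blockB j) <= 1)%E.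
Proof.
under eq_bigr do rewrite lebesgue_block.
rewrite sumEFin lee_fin sumr_const card_ord -[_ *+ _]mulr_natl.
by rewrite ler_pdivrMr ?l_pos_real// mul1r Ml.
Qed.

Lemma blockhE j t : blockB j t -> blockh t = a j.
Proof.
move=> Bj; rewrite /blockh (bigD1 j)//= indicE mem_set// mulr1.
rewrite big1 ?addr0// => i ij; rewrite indicE memNset ?mulr0// => Bi.
have : (blockB i `&` blockB j) t by [].
rewrite disjoint_B//; apply: S_disjoint => /idx_inj h.
by move: ij; rewrite h eqxx.
Qed.

Lemma blockh_distr (tau : R) : 0 <= tau ->
  (distr H blockh tau <= (#|[pred j | tau < a j]|%:R / (l k)%:R)%:E)%E.
Proof.
move=> tau0.
pose G j := if tau < a j then blockB j else set0.
have mG j : measurable (G j) by rewrite /G; case: ifP => // _; exact: measurable_blockB.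
apply: le_trans (le_measure_cover (s := index_enum 'I_M) mG _ _) _.
- apply: measurable_superlevel; first exact: measurable_half_line.
  by apply: measurable_funTS; exact: measurable_blockh.
- move=> t [_ /= ht]; have [[j Bj]|none] := pselect (exists j, blockB j t).
    exists j; rewrite ?mem_index_enum// /G.
    by move: ht; rewrite (blockhE Bj) ger0_norm// => ->.
  exfalso; move: ht; rewrite /blockh big1 ?normr0 ?ltNge ?tau0// => j _.
  by rewrite indicE memNset ?mulr0// => Bj; apply: none; exists j.
- rewrite (eq_bigr (fun j => ((if tau < a j then 1 else 0) / (l k)%:R)%:E)); last first.
    move=> j _; rewrite /G; case: ifP => _; first by rewrite lebesgue_block mul1r.
    by rewrite measure0 mul0r.
  rewrite sumEFin lee_fin -mulr_suml -big_mkcond /=.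
  by rewrite sumr_const.
Qed.

Lemma block_bound (CT : R) (x : R -> R) : 0 < CT ->
  (forall f, U_space N A f -> (N (T f) <= CT%:E * Z_norm N f)%E) ->
  in_space D N x ->
  (forall tau : R, 0 <= tau -> (distr H blockh tau <= distr D x tau)%E) ->
  in_space D N (wsum blockY a) /\ (N (wsum blockY a) <= CT%:E * N x)%E.
Proof.
move=> CT0 Tbound xN hx.
have [Tin Tlin _] := T_emb.
have BU j : U_space N A \1_(blockB j) by exact: B_in_U.
have Uh : U_space N A blockh.
  exact: (U_space_lincomb A_meas A_sub A_disj E_ri BU a sum_blockB).
have Th : ae_eq m D (T blockh) (fun t => \sum_(j <- index_enum 'I_M) a j * T \1_(blockB j) t).
  exact: (T_lincomb A_meas A_sub A_disj E_ri BU Tlin a sum_blockB).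
have mW : measurable_fun D (wsum blockY a).
  by apply: measurable_wsum => j; exact: blockY_measurable.
have ThN := Tin _ Uh.
have h1 : (N (wsum blockY a) <= N (T blockh))%E.
  apply: (ri_ideal E_ri.1) => //; apply: filterS Th => t h Dt.
  rewrite h// (_ : wsum blockY a t = \sum_j a j * T \1_(blockB j) t)//.
  by apply: eq_bigr => j _; rewrite /blockY y_def.
have h2 : (N (wsum blockY a) <= CT%:E * N x)%E.
  apply: (le_trans h1); apply: (le_trans (Tbound _ Uh)).
  apply: lee_wpmul2l; first by rewrite lee_fin ltW.
  apply: Z_norm_le => //; apply: measurable_funTS; exact: measurable_blockh.
split => //; split => //; apply: le_lt_trans h1 ThN.2.
Qed.

End Block.

(** * Decay of the fundamental function *)

Section FundamentalFunction.
Variable CT : R.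
Hypothesis CT0 : 0 < CT.
Hypothesis Tbound : forall f, U_space N A f -> (N (T f) <= CT%:E * Z_norm N f)%E.

Lemma beta_le_l k : beta / (l k)%:R <= 1.
Proof.
have [i Fi] := F_nonempty k; rewrite -lee_fin; apply: (le_trans (y_large Fi)).
rewrite -lebesgue_unit_interval; apply: le_measure; rewrite ?inE.
- apply: measurable_superlevel; [exact: measurable_unit_interval|exact: measurable_y].
- exact: measurable_unit_interval.
- exact: subIsetl.
Qed.

(** With all coefficients 1, [h] is dominated by the indicator of [[0,1]], of norm 1, so
    [N W <= CT]. Keeping only the full index set in [wsum_lower] shows that [W] exceeds every level
    below [alpha * M] with probability at least [rho / 2], and the 2 is absorbed by a dilation.
    [rho] is left free because the exponent [gamma * l k] need not be an integer. *)
Lemma fundamental_block_bound k (M : nat) (rho : R) : (0 < M)%N ->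
  (M <= #|` F k|)%N -> 0 <= rho -> rho <= (beta / (2 * (l k)%:R)) ^+ M ->
  (fundamental_function N rho <= (2 * CT / (alpha * M%:R))%:E)%E.
Proof.
move=> M0 MF rho0 rhoM.
have l0 := l_pos_real k; have bl := beta_le_l k.
pose q := beta / (l k)%:R.
have qE : beta / (2 * (l k)%:R) = q / 2 by rewrite /q; field; rewrite gt_eqF.
have q0 : 0 < q by rewrite divr_gt0.
have rho1 : 0 <= rho <= 1.
  rewrite rho0 (le_trans rhoM)// qE exprn_ile1//; first by lra.
  by rewrite /q; lra.
pose a := fun j : 'I_M => 1 : R.
have a0 j : 0 <= a j by [].
have one_in : in_space D N \1_D by split; [exact: measurable_indic measurable_unit_interval|rewrite E_ri.2 ltry].
have hx (tau : R) : 0 <= tau -> (distr H (blockh k a) tau <= distr D \1_D tau)%E.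
  move=> tau0; have [t1|t1] := ltP tau 1.
    rewrite distr_indic ?tau0// setIid lebesgue_unit_interval.
    apply: le_trans (blockh_distr MF a0 tau0) _; rewrite lee_fin.
    rewrite ler_pdivrMr ?l_pos_real// mul1r; apply: le_trans (Ml MF).
    by rewrite ler_nat -[X in (_ <= X)%N]card_ord max_card.
  rewrite (_ : distr H _ _ = 0%E); first exact: measure_ge0.
  apply/eqP; rewrite eq_le measure_ge0 andbT.
  apply: le_trans (blockh_distr MF a0 tau0) _; rewrite lee_fin.
  rewrite (_ : #|_| = 0%N) ?mul0r//; apply: eq_card0 => j.
  by rewrite inE /a ltNge t1.
have [Win Wle] := block_bound MF CT0 Tbound one_in hx.
rewrite E_ri.2 mule1 in Wle.
have Y1 := @blockY_measurable k M.
have Y2 := blockY_independent MF.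
have Y3 := @blockY_symmetric k M.
have Wtail (tau : R) : tau < alpha * M%:R ->
    rho <= 2 * fine (distr D (wsum (@blockY k M) a) tau).
  move=> tauM.
  have := wsum_lower Y1 Y2 Y3 alpha_pos a0 M tau q0 (blockY_tail MF).
  rewrite (bigD1 finset.setT)/=; last first.
    by rewrite /good cardsT card_ord eqxx /= /a sumr_const cardsT card_ord.
  rewrite subnn expr0 mulr1 => h; apply: (le_trans rhoM); rewrite qE.
  have dbl (u v w : R) : (u + v) / 2 <= w -> 0 <= v -> u <= 2 * w by lra.
  by apply: (dbl _ _ _ h); rewrite sumr_ge0// => J _; rewrite exprn_ge0//; lra.
have M0' : 0 < M%:R :> R by rewrite ltr0n.
have aM0 : 0 < alpha * M%:R by rewrite mulr_gt0.
pose x (t : R) := alpha * M%:R * \1_(`[0, rho]) t.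
have rin := in_space_initial E_ri rho.
have xin : in_space D N x by exact: (in_space_scale E_ri.1).
have dil : (N x <= 2%:R%:E * N (wsum (@blockY k M) a))%E.
  apply: (ri_dilation E_ri.1) => //; first exact: xin.1.
  move=> tau tau0; have [tM|tM] := leP (alpha * M%:R) tau.
    rewrite (distr_ge_bound (M := alpha * M%:R)) ?mule_ge0 ?measure_ge0//.
    move=> t _; rewrite /x normrM (gtr0_norm aM0) ler_piMr ?(ltW aM0)//.
    exact: normr_indic_le1.
  apply: (@le_trans _ _ rho%:E).
    rewrite -(lebesgue_initial rho1); apply: le_measure; rewrite ?inE.
    - apply: measurable_superlevel; [exact: measurable_unit_interval|exact: xin.1].
    - by apply: measurableI; [exact: measurable_unit_interval|exact: measurable_itv].
    - move=> t [Dt /= ht]; split => //; apply: contrapT => nt; move: ht.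
      by rewrite /x indicE memNset// mulr0 normr0 ltNge (ltW tau0).
  rewrite -(fineK (distr_unit_fin tau Win.1)) -EFinM lee_fin.
  exact: Wtail.
rewrite (ri_homogeneous E_ri.1)// (gtr0_norm aM0) in dil.
rewrite /fundamental_function -(fineK (ri_fin E_ri.1 rin)) in dil *.
have Wf := ri_fin E_ri.1 Win.
rewrite -(fineK Wf) -!EFinM !lee_fin in dil Wle *.
rewrite ler_pdivlMr// mulrC (le_trans dil)//.
by rewrite ler_pM2l.
Qed.

Lemma fundamental_bound : exists C : R, 0 < C /\ forall k,
  (fundamental_function N ((beta / (2 * (l k)%:R)) `^ (gamma * (l k)%:R))
   <= (C / (l k)%:R)%:E)%E.
Proof.
(* The second term serves the [k] with [gamma * l k < 1], where the fundamental function is bounded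
   by 1. Otherwise the integer part [M] of [gamma * l k] is at least half of it, which turns the 2
   of [fundamental_block_bound] into 4. *)
exists (4 * CT / (alpha * gamma) + gamma^-1); split.
  by rewrite addr_gt0// ?invr_gt0// divr_gt0// mulr_gt0.
move=> k; have l0 := l_pos_real k; have bl := beta_le_l k.
pose b := beta / (2 * (l k)%:R).
have bE : b = beta / (l k)%:R / 2 by rewrite /b; field; rewrite gt_eqF.
have b0 : 0 < b by rewrite divr_gt0// mulr_gt0.
have b1 : b <= 1 by rewrite bE; lra.
have gl0 : 0 < gamma * (l k)%:R by rewrite mulr_gt0.
have rho0 : 0 <= b `^ (gamma * (l k)%:R) by exact: powR_ge0.
have ag0 : 0 < alpha * gamma by rewrite mulr_gt0.
have [gl1|gl1] := ltP (gamma * (l k)%:R) 1.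
  apply: (@le_trans _ _ 1%E).
    rewrite -E_ri.2; apply: (ri_ideal E_ri.1) => //.
      by split; [exact: measurable_indic measurable_unit_interval|rewrite E_ri.2 ltry].
    apply: aeW => t Dt; rewrite [in leRHS]indicE mem_set// normr1.
    exact: normr_indic_le1.
  rewrite lee_fin ler_pdivlMr// mul1r.
  apply: (@le_trans _ _ gamma^-1).
    by rewrite -(ler_pM2l gamma_pos) mulfV ?gt_eqF// ltW.
  by rewrite lerDr divr_ge0 ?(ltW ag0)// mulr_ge0// ltW.
pose M := Num.truncn (gamma * (l k)%:R).
have /andP[M1 M2] := truncn_itv (ltW gl0).
have M0 : (0 < M)%N by rewrite /M truncn_gt0.
have MF : (M <= #|` F k|)%N.
  by have [h _] := F_card k; rewrite -(ler_nat R) (le_trans M1).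
have rhoM : b `^ (gamma * (l k)%:R) <= b ^+ M.
  rewrite -powR_mulrn ?(ltW b0)//; apply: ger_powR => //.
  by rewrite b0 b1.
apply: (le_trans (fundamental_block_bound M0 MF rho0 rhoM)); rewrite lee_fin.
have M0' : 0 < M%:R :> R by rewrite ltr0n.
have glM : gamma * (l k)%:R <= 2 * M%:R.
  by have : 1 <= M%:R :> R by [rewrite ler1n]; move: M2; rewrite -/M -natr1; lra.
apply: (@le_trans _ _ (4 * CT / (alpha * gamma) / (l k)%:R)); last first.
  by rewrite ler_pM2r ?invr_gt0// lerDl invr_ge0 ltW.
have -> : 4 * CT / (alpha * gamma) / (l k)%:R = 2 * CT / (alpha * (gamma * (l k)%:R / 2)).
  by field; rewrite !gt_eqF.
rewrite ler_pM2l ?mulr_gt0// lef_pV2 ?posrE ?mulr_gt0//.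
by rewrite ler_pM2l//; lra.
Qed.

End FundamentalFunction.

(** * The Kruglov operator *)

Section KruglovCore.
Variable CT : R.
Hypothesis CT0 : 0 < CT.
Hypothesis Tbound : forall f, U_space N A f -> (N (T f) <= CT%:E * Z_norm N f)%E.

(** Lowering [beta] keeps the tail bounds valid, and the cap [1/2] gives [M q <= 1/2] for
    [q = beta' / l k] and [M <= l k]. *)
Let beta' : R := Num.min beta 2^-1.

Let beta'0 : 0 < beta'. Proof. by rewrite lt_min beta_pos invr_gt0 ltr0n. Qed.

Let theta : R := gamma * beta' / 4.

Let theta0 : 0 < theta. Proof. by rewrite divr_gt0// mulr_gt0. Qed.

Lemma kruglov_sum_bound : exists2 C1 : R, 0 < C1 & kruglov_sum_bounded N C1.
Proof.
have [c [c0 hc]] := kruglov_constant theta0.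
(* [c] is the cost of a dilation, [2 / alpha] undoes the halving of [tau] and the threshold [alpha]
   carried by [W], and [CT] bounds [T]. None of them depends on [k], [P] or the simple function. *)
exists (c%:R * (2 / alpha * CT)).
  by rewrite !mulr_gt0 ?ltr0n ?invr_gt0.
move=> r P v s0 X0 E X v0 vs0 mX0 X0N mE E_disj mX mvX XE.
pose p s := pr [set t | X0 t = s].
have p0 s : 0 <= p s by exact: pr_ge0.
have pE s : (p s)%:E = m (D `&` [set t | X0 t = s]).
  by rewrite /p /pr fineK//; exact: prob01_fin.
have sum_p (Q : pred 'I_r) (Z : set R) : measurable Z ->
    (forall s, Q s -> D `&` [set t | X0 t = s] `<=` Z) ->
    ((\sum_(s | Q s) p s)%:E <= m Z)%E.
  move=> mZ QZ; rewrite -sumEFin; under eq_bigr do rewrite pE.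
  rewrite -big_filter; apply: sum_measure_disjoint_le => //.
  - by rewrite filter_uniq// index_enum_uniq.
  - move=> i j _ _ /eqP ij; rewrite -subset0 => t [[_ /= h1] [_ /= h2]].
    by apply: ij; rewrite -h1 h2.
  - by move=> s; rewrite mem_filter => /andP[Qs _]; exact: QZ.
have p1 : \sum_s p s <= 1.
  rewrite -lee_fin -lebesgue_unit_interval; apply: sum_p; first exact: measurable_unit_interval.
  by move=> s _; exact: subIsetl.
(* Size required of [F k]: room for index sets of up to [P] elements, and enough indices for each
   code of positive probability. Codes of probability 0 contribute 0, division by zero being 0. *)
pose L : R := P.+1%:R + \sum_s 2 * P.+1%:R / p s.
have [k hk] := l_unbounded (L / gamma).
rewrite ler_pdivrMr// mulrC in hk.
pose M := #|` F k|.
have [FM Fl] := F_card k.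
have LM : L <= M%:R by exact: le_trans hk FM.
have L0 s : 0 <= 2 * P.+1%:R / p s by rewrite divr_ge0.
have PM : (P.+1 <= M)%N.
  rewrite -(ler_nat R) (le_trans _ LM)// /L lerDl; apply: sumr_ge0 => s _; exact: L0.
have M0 : (0 < M)%N by exact: leq_trans PM.
have MF : (M <= #|` F k|)%N by [].
have psmall s : p s = 0 \/ 2 * P.+1%:R <= M%:R * p s.
  have [ps|ps] := eqVneq (p s) 0; [by left|right].
  have ps0 : 0 < p s by rewrite lt_def ps p0.
  rewrite -ler_pdivrMr//; apply: le_trans LM.
  rewrite /L (bigD1 s)//= addrCA lerDl addr_ge0//.
  by apply: sumr_ge0 => i _; exact: L0.
(* Rounding down serves twice: the quotas fit into [M] indices, and a code other than [s0] occupies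
   measure at most [M * p s / l k <= p s], so that [h] is dominated by the simple function. *)
have cM : (\sum_s Num.truncn (M%:R * p s) <= M)%N.
  rewrite -(ler_nat R) natr_sum.
  apply: (@le_trans _ _ (\sum_s M%:R * p s)).
    apply: ler_sum => s _; have /andP[] := truncn_itv (mulr_ge0 (ler0n R M) (p0 s)).
    by [].
  by rewrite -mulr_sumr ler_piMr.
have [sigma [fib1 fib2]] := fibers_exist s0 cM.
have fib s : M%:R * p s - 1 <= #|[pred j | sigma j == s]|%:R.
  have /andP[_ h] := truncn_itv (mulr_ge0 (ler0n R M) (p0 s)).
  have := fib1 s; rewrite -(ler_nat R); move: h; rewrite -natr1; lra.
pose a j := v (sigma j).
have a0 j : 0 <= a j by exact: v0.
have hx (tau : R) : 0 <= tau ->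
    (distr H (blockh k a) tau <= distr D (fun t => v (X0 t)) tau)%E.
  move=> tau0; apply: le_trans (blockh_distr MF a0 tau0) _.
  apply: (@le_trans _ _ (\sum_(s | tau < v s) p s)%:E).
    rewrite lee_fin ler_pdivrMr ?l_pos_real//.
    rewrite -sum1_card (partition_big sigma (fun s => tau < v s))//=.
    rewrite natr_sum mulr_suml; apply: ler_sum => s vs.
    have ss0 : s != s0.
      by apply: contraTneq vs => ->; rewrite vs0 -leNgt.
    apply: (@le_trans _ _ #|[pred j | sigma j == s]|%:R).
      rewrite sum1_card ler_nat; apply/subset_leq_card/fintype.subsetP => j.
      by rewrite !inE => /andP[].
    rewrite fib2//; have /andP[h _] := truncn_itv (mulr_ge0 (ler0n R M) (p0 s)).
    by apply: (le_trans h); rewrite mulrC ler_wpM2l// ler_nat.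
  apply: sum_p.
    by apply: measurable_superlevel; [exact: measurable_unit_interval|exact: X0N.1].
  move=> s vs t [Dt /= ts]; split => //=.
  by rewrite ts ger0_norm.
have [Win Wle] := block_bound MF CT0 Tbound X0N hx.
pose W := wsum (@blockY k M) a.
pose q := beta' / (l k)%:R.
have l0 := l_pos_real k.
have q0 : 0 < q by rewrite divr_gt0.
have qp j : q <= tailp (@blockY k M) alpha j.
  apply: le_trans (blockY_tail MF j); rewrite ler_pM2r ?invr_gt0//.
  by rewrite ge_min lexx.
have b2 : beta' <= 2^-1 by rewrite ge_min lexx orbT.
have Mq : M%:R * q <= 2^-1.
  apply: le_trans b2; rewrite /q mulrCA ler_piMr ?(ltW beta'0)//.
  by rewrite ler_pdivrMr// mul1r ler_nat.
have kM : gamma * beta' <= M%:R * q.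
  rewrite /q mulrCA mulrC ler_wpM2l ?(ltW beta'0)//.
  by rewrite ler_pdivlMr.
have gb0 : 0 <= gamma * beta' by rewrite mulr_ge0// ltW.
have Wtail n (tau : R) : (0 < n <= P)%N ->
    iid_tail p v (uphalf n) tau <=
    4 * ((uphalf n)`!%:R / theta ^+ uphalf n) * fine (distr D W (alpha * tau)).
  move=> /andP[n0 nP].
  have hn : (uphalf n <= n)%N by rewrite leq_uphalf_double -addnn leq_addr.
  have hnP : (uphalf n <= P)%N by exact: leq_trans nP.
  have hnM : (uphalf n <= M)%N by apply: leq_trans hnP _; exact: ltnW.
  have := wsum_tail_ge (@blockY_measurable k M) (blockY_independent MF)
    (@blockY_symmetric k M) p0 v0 tau alpha_pos q0 qp Mq gb0 kM M0 psmall fib hnP hnM.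
  rewrite -/theta -/W; set w := fine _; set x := iid_tail _ _ _ _; move=> h.
  have f0 : 0 < (uphalf n)`!%:R :> R by rewrite ltr0n fact_gt0.
  have t0 : 0 < theta ^+ uphalf n by rewrite exprn_gt0.
  have := ler_wpM2l (ltW (mulr_gt0 (ltr0Sn R 3) (divr_gt0 f0 t0))) h.
  congr (_ <= _).
  by field; rewrite !gt_eqF.
have q_meas : measurable_fun D (kruglov_sum v E X P).
  by apply: measurable_kruglov_sum.
pose g (t : R) := 2 / alpha * W t.
have gin : in_space D N g by exact: (in_space_scale E_ri.1).
have a2 : 0 < 2 / alpha by rewrite divr_gt0.
have gdistr (tau : R) : distr D g tau = distr D W (alpha * (tau / 2)).
  rewrite /distr; congr (m (_ `&` _)); apply/seteqP.
  have e : alpha * (tau / 2) = tau / (2 / alpha) by field; rewrite gt_eqF.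
  by split => t /=; rewrite /g normrM (gtr0_norm a2) e ltr_pdivrMr// mulrC.
have dil : (N (kruglov_sum v E X P) <= c%:R%:E * N g)%E.
  apply: (ri_dilation E_ri.1) => // tau tau0.
  apply: le_trans (kruglov_sum_tail p0 v0 mE E_disj mX mvX XE P tau0) _.
  have gm : measurable_fun D g := gin.1.
  rewrite -(fineK (distr_unit_fin tau gm)) -EFinM lee_fin gdistr.
  set w := fine _.
  have w0 : 0 <= w by apply: fine_ge0; exact: measure_ge0.
  apply: le_trans (ler_wpM2r w0 (hc P)); rewrite mulr_suml.
  rewrite big_nat [leRHS]big_nat; apply: ler_sum => n; rewrite ltnS => nP.
  have f0 : 0 <= 2 * (n`!%:R)^-1 :> R by rewrite mulr_ge0// invr_ge0.
  apply: (le_trans (ler_wpM2l f0 (Wtail n (tau / 2) nP))); rewrite -/w.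
  rewrite le_eqVlt; apply/orP; left; apply/eqP.
  by field; rewrite !gt_eqF// ?ltr0n ?fact_gt0// exprn_gt0.
have Nle : (N (kruglov_sum v E X P) <=
    (c%:R * (2 / alpha * CT))%:E * N (fun t => v (X0 t)))%E.
  apply: (le_trans dil); rewrite (ri_homogeneous E_ri.1)// (gtr0_norm a2).
  have -> : (c%:R * (2 / alpha * CT))%:E = (c%:R%:E * ((2 / alpha)%:E * CT%:E))%E.
    by rewrite -!EFinM.
  rewrite -!muleA; apply: lee_wpmul2l; first by rewrite lee_fin.
  apply: lee_wpmul2l => //.
  by rewrite lee_fin ltW.
split => //; split => //; apply: (le_lt_trans Nle).
by rewrite -(fineK (ri_fin E_ri.1 X0N)) -EFinM ltry.
Qed.

End KruglovCore.

End Main.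

(** * Discretization of |f| by finitely many levels *)

Section Coding.
Context {R : realType} (g : nat).
Local Notation m := (@lebesgue_measure R).
Local Notation D := (@unit_interval R).

Let K := (g.+1 ^ 2)%N.

Definition level (s : 'I_K.+1) : R := s%:R / g.+1%:R.

(** Rounds [|x|] down to a multiple of [1/(g+1)] and caps it at [g+1]. The approximations are not
    monotone in [g], so the later limit passage rests on Fatou rather than on monotone
    convergence. *)
Definition code (x : R) : 'I_K.+1 := inord (minn (Num.truncn (g.+1%:R * `|x|)) K).

Lemma levelE x : level (code x) = (minn (Num.truncn (g.+1%:R * `|x|)) K)%:R / g.+1%:R.
Proof. by rewrite /level /code inordK// ltnS geq_minr. Qed.

Lemma level_ge0 s : 0 <= level s.
Proof. by rewrite divr_ge0. Qed.

Lemma level0 : level ord0 = 0.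
Proof. by rewrite /level mul0r. Qed.

Lemma level_inj : injective level.
Proof.
move=> i j; rewrite /level => /(divIf _) h; apply: val_inj; apply/eqP.
by rewrite -(eqr_nat R); apply/eqP; apply: h; rewrite pnatr_eq0.
Qed.

Lemma level_code_le x : level (code x) <= `|x|.
Proof.
rewrite levelE ler_pdivrMr ?ltr0n// [leRHS]mulrC.
have h : 0 <= g.+1%:R * `|x| by rewrite mulr_ge0.
apply: (@le_trans _ _ (Num.truncn (g.+1%:R * `|x|))%:R); last by rewrite truncn_le.
by rewrite ler_nat geq_minl.
Qed.

Lemma level_code_ge x : `|x| <= g%:R -> `|x| - g.+1%:R^-1 <= level (code x).
Proof.
move=> xg; rewrite levelE ler_pdivlMr ?ltr0n// mulrBl mulVf ?pnatr_eq0//.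
have h : 0 <= g.+1%:R * `|x| by rewrite mulr_ge0.
have /andP[h1 h2] := truncn_itv h.
rewrite (minn_idPl _).
  by rewrite lerBlDr [leLHS]mulrC natr1 ltW.
rewrite -(ler_nat R) (le_trans h1)// /K natrX expr2 ler_pM2l ?ltr0n//.
by rewrite (le_trans xg)// ler_nat.
Qed.

Lemma measurable_level_code : measurable_fun setT (fun x => level (code x)).
Proof.
pose h (z : R) : R := (minn (Num.truncn (g.+1%:R * z)) K)%:R / g.+1%:R.
have mh : measurable_fun setT h.
  apply: nondecreasing_measurable => // u w uw.
  rewrite /h ler_pM2r ?invr_gt0 ?ltr0n// ler_nat leq_min geq_minr andbT geq_min.
  by rewrite le_truncn// ler_pM2l ?ltr0n.
under eq_fun do rewrite levelE.
exact: (measurableT_comp mh (@measurable_realfun.normr_measurable R setT)).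
Qed.

Lemma measurable_code_fiber s : measurable [set x | code x = s].
Proof.
have -> : [set x | code x = s] = setT `&` (fun x => level (code x)) @^-1` [set level s].
  rewrite setTI; apply/seteqP; split => x /=; first by move=> ->.
  exact: level_inj.
exact: measurable_level_code.
Qed.

End Coding.

Section CodingLimit.
Context {R : realType}.

Lemma level_code_cvg (x : R) : level (code g x) @[g --> \oo] --> `|x|.
Proof.
apply: (@squeeze_cvgr _ _ _ _ (fun g : nat => `|x| - g.+1%:R^-1) (fun=> `|x|)).
- exists (Num.truncn `|x|).+1 => // g /= xg.
  rewrite level_code_le level_code_ge//.
  by rewrite (le_trans (ltW (truncnS_gt `|x|)))// ler_nat.
- rewrite -[X in _ --> X]subr0; apply: cvgB; first exact: cvg_cst.
  exact: cvg_harmonic.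
- exact: cvg_cst.
Qed.

Lemma cvg_sum_ord n (f : 'I_n -> nat -> R) (a : 'I_n -> R) :
  (forall i, f i g @[g --> \oo] --> a i) ->
  \sum_(i < n) f i g @[g --> \oo] --> \sum_(i < n) a i.
Proof.
elim: n f a => [|n IH] f a h.
  by under eq_fun do rewrite big_ord0; rewrite big_ord0; exact: cvg_cst.
under eq_fun do rewrite big_ord_recl; rewrite big_ord_recl.
by apply: cvgD; [exact: h|exact: IH].
Qed.

End CodingLimit.

(** * From simple functions to arbitrary f *)

Section KruglovOperator.
Context {R : realType}.
Local Notation m := (@lebesgue_measure R).
Local Notation D := (@unit_interval R).
Variable N : (R -> R) -> \bar R.
Hypothesis ri : ri_space D N.
Variable C1 : R.
Hypothesis C10 : 0 < C1.
Hypothesis bounded : kruglov_sum_bounded N C1.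

(** [z] is scaled by a positive upper bound [r0] of its norm rather than by the norm itself, which
    may vanish. *)
Lemma kothe_dual_le z x (r0 : R) : in_space D N z -> measurable_fun D x ->
  (kothe_dual D N x <= 1)%E -> 0 < r0 -> (N z <= r0%:E)%E ->
  (\int[m]_(t in D) (`|x t * z t|)%:E <= r0%:E)%E.
Proof.
move=> zN mx x1 r00 zr.
pose z' (t : R) := r0^-1 * z t.
have z'N : in_space D N z' by exact: (in_space_scale ri).
have z'1 : (N z' <= 1)%E.
  rewrite (ri_homogeneous ri)// ger0_norm; last by rewrite invr_ge0 ltW.
  rewrite -(fineK (ri_fin ri zN)) -EFinM lee_fin mulrC ler_pdivrMr// mul1r.
  by rewrite -lee_fin fineK// ri_fin.
have h : (\int[m]_(t in D) (`|z' t * x t|)%:E <= 1)%E.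
  apply: le_trans x1; apply: ereal_sup_ubound.
  by exists z'.
have -> : (\int[m]_(t in D) (`|x t * z t|)%:E = r0%:E * \int[m]_(t in D) (`|z' t * x t|)%:E)%E.
  rewrite -ge0_integralZl_EFin//; last exact: ltW.
  - apply: eq_integral => t _; rewrite -EFinM; congr EFin.
    rewrite /z' !normrM normfV (gtr0_norm r00).
    by field; rewrite gt_eqF.
  - exact: measurable_unit_interval.
  - apply/measurable_EFinP; apply: measurableT_comp => //.
    by apply: measurable_funM => //; exact: z'N.1.
by rewrite -[leRHS]mule1; apply: lee_wpmul2l => //; rewrite lee_fin ltW.
Qed.

Lemma kruglov_bounded K : kruglov_operator K ->
  bounded_operator D N D (kothe_dual D (kothe_dual D N)) K.
Proof.
move=> [E [FF [hE E_disj hK]]]; exists C1 => f fN.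
have mf := fN.1.
have [hF hI hKf] := hK f mf.
have mE n : (0 < n)%N -> measurable (E n) by move=> /hE[].
have ED n : (0 < n)%N -> E n `<=` D by move=> /hE[].
(* The copies of [f] themselves are coded: their codes are independent copies of the code of [f],
   whereas copies chosen for different functions need not be related at all. *)
pose X g n (i : 'I_n) (t : R) := code g (FF f n i t).
pose q g := kruglov_sum (@level R g) E (X g) g.
have mFF n (i : 'I_n) : measurable_fun D (FF f n i) by have [] := hF n i (ltn_ord i).
have X0N g : in_space D N (fun t => level (code g (f t))).
  have mlf : measurable_fun D (fun t => level (code g (f t)) : R).
    exact: measurableT_comp (@measurable_level_code R g) mf.
  split => //; apply: le_lt_trans fN.2; apply: (ri_ideal ri) => //.
  by apply: aeW => t _; rewrite ger0_norm ?level_ge0//; exact: level_code_le.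
have X0le g : (N (fun t => level (code g (f t))) <= N f)%E.
  apply: (ri_ideal ri) => //; first exact: (X0N g).1.
  by apply: aeW => t _; rewrite ger0_norm ?level_ge0//; exact: level_code_le.
have mvX g n (i : 'I_n) : measurable_fun D (fun t => level (X g n i t) : R).
  exact: measurableT_comp (@measurable_level_code R g) (mFF n i).
have qN g : in_space D N (q g) /\ (N (q g) <= C1%:E * N f)%E.
  have [|||||||||h1 h2] := @bounded _ g (@level R g) ord0 (fun t => code g (f t)) E (X g).
  - exact: level_ge0.
  - exact: level0.
  - by move=> s; exact: measurable_unit_preimage mf (measurable_code_fiber s).
  - exact: X0N.
  - exact: mE.
  - exact: E_disj.
  - by move=> n i s; exact: measurable_unit_preimage (mFF n i) (measurable_code_fiber s).
  - exact: mvX.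
  - move=> n s w n0 us.
    (* Independence speaks of functions, so the event [E n] enters as the set where its indicator
       exceeds [1/2]. *)
    pose B (j : option 'I_n) : set R :=
      if j is Some i then [set x | code g x = w i] else `]2^-1, +oo[%classic.
    have mB j : measurable (B j).
      by case: j => [i|] /=; [exact: measurable_code_fiber|exact: measurable_itv].
    have us' : uniq (None :: map Some s).
      rewrite /= map_inj_uniq ?us ?andbT; last by move=> i j [].
      by apply/mapP => -[].
    have E1 t : E n t <-> (\1_(E n) t : R) \in `]2^-1, +oo[.
      rewrite in_itv/= andbT indicE; split => h; first by rewrite mem_set// invf_lt1 ?ltr1n.
      apply: contrapT => nE; move: h; rewrite memNset//.
      by rewrite ltNge invr_ge0 ler0n.
    have -> : D `&` E n `&` pattern (X g n) w s = D `&` \bigcap_(j in [set` None :: map Some s])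
        ((if j is Some i then FF f n i else \1_(E n)) @^-1` B j).
      apply/seteqP; split => t.
        move=> [[Dt Et] pt]; split => // -[i|] /=; last by move=> _; exact/E1.
        rewrite inE /= mem_map; last by move=> ? ? [].
        exact: pt.
      move=> [Dt h]; split; [split => //|].
        by apply/E1; apply: (h None); rewrite /= mem_head.
      move=> i is_; apply: (h (Some i)).
      by rewrite /= inE /= mem_map//; move=> ? ? [].
    have := hI n n0 _ B us' mB; rewrite /prob01 => ->.
    rewrite big_cons big_map /=.
    have -> : D `&` (\1_(E n) : R -> R) @^-1` `]2^-1, +oo[ = E n.
      apply/seteqP; split => t; first by move=> [_] /E1.
      by move=> Et; split; [exact: (ED n n0)|exact/E1].
    have [_ _ ->] := hE n n0.
    rewrite EFinM; apply: lee_wpmul2l.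
      by rewrite lee_fin invr_ge0 mulr_ge0 ?expR_ge0.
    rewrite -prodEFin le_eqVlt; apply/orP; left; apply/eqP.
    apply: eq_bigr => i _; have [_ id_] := hF n i (ltn_ord i).
    rewrite -/(prob01 _) id_; last exact: measurable_code_fiber.
    rewrite /pr fineK//; apply: prob01_fin.
    exact: measurable_unit_preimage mf (measurable_code_fiber (w i)).
  split => //; apply: (le_trans h2); apply: lee_wpmul2l => //.
  by rewrite lee_fin ltW.
pose G p t : R := \sum_(1 <= n < p) \sum_(i < n) FF f n i t * \1_(E n) t.
have GE p n t : (0 < n < p)%N -> E n t -> G p t = \sum_(i < n) FF f n i t.
  move=> /andP[n0 np] Et; rewrite /G (bigD1_seq n)/= ?iota_uniq//; last first.
    by rewrite mem_index_iota n0.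
  rewrite [X in _ + X]big1_seq ?addr0; last first.
    move=> k /andP[kn]; rewrite mem_index_iota => /andP[k0 _].
    rewrite big1// => i _; rewrite indicE memNset ?mulr0// => Ek.
    by move/eqP: kn; apply; apply: (E_disj k n) => //; exists t.
  by apply: eq_bigr => i _; rewrite indicE mem_set// mulr1.
have G0 p t : (forall n, (0 < n)%N -> ~ E n t) -> G p t = 0.
  move=> nE; rewrite /G big1_seq// => n; rewrite mem_index_iota => /andP[_ /andP[n0 _]].
  by rewrite big1// => i _; rewrite indicE memNset ?mulr0//; exact: nE.
have q0 g t : (forall n, (0 < n)%N -> ~ E n t) -> q g t = 0.
  move=> nE; rewrite /q /kruglov_sum big1_seq// => n.
  rewrite mem_index_iota => /andP[_ /andP[n0 _]].
  by rewrite big1// => i _; rewrite indicE memNset ?mulr0//; exact: nE.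
pose L t : R := limn (fun g => q g t).
have cases t : D t -> (exists2 n, (0 < n)%N & E n t) \/ (forall n, (0 < n)%N -> ~ E n t).
  move=> Dt; have [|none] := pselect (exists2 n, (0 < n)%N & E n t); first by left.
  by right => n n0 En; apply: none; exists n.
have Glim t : D t -> G p t @[p --> \oo] --> K f t.
  move=> Dt; have -> : K f t = limn (fun p => G p t) by exact: hKf.
  have [[n n0 En]|none] := cases t Dt.
    have c : \forall p \near \oo, G p t = \sum_(i < n) FF f n i t.
      by exists n.+1 => // p /= np; apply: GE => //; rewrite n0.
    by apply/cvg_ex; eexists; apply: cvg_near_cst; exact: c.
  have c : \forall p \near \oo, G p t = 0 by apply: nearW => p; exact: G0.
  by apply/cvg_ex; eexists; apply: cvg_near_cst; exact: c.
(* At most one [E n] contains [t], so the limit is a finite sum of the [|F f n i t|]. It bounds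
   [|K f t|] by the triangle inequality, which reduces signed [f] to nonnegative simple
   functions. *)
have qlim t : D t -> q g t @[g --> \oo] --> L t /\ `|K f t| <= L t.
  move=> Dt; have [[n n0 En]|none] := cases t Dt.
    have c : q g t @[g --> \oo] --> \sum_(i < n) `|FF f n i t|.
      have : \forall g \near \oo, \sum_(i < n) level (code g (FF f n i t)) = q g t.
        exists n => // g /= ng; by rewrite /q (kruglov_sumE _ E_disj _ _ En)// n0.
      move=> h; apply: (cvg_trans (near_eq_cvg h)).
      by apply: cvg_sum_ord => i; exact: level_code_cvg.
    have -> : L t = \sum_(i < n) `|FF f n i t| by apply: cvg_lim.
    split => //; have -> : K f t = \sum_(i < n) FF f n i t.
      apply: (cvg_unique _ (Glim t Dt)) => //; apply: cvg_near_cst.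
      by exists n.+1 => // p /= np; apply: GE => //; rewrite n0.
    exact: ler_norm_sum.
  have c : q g t @[g --> \oo] --> (0 : R).
    by apply: cvg_near_cst; apply: nearW => g; exact: q0.
  have -> : L t = 0 by apply: cvg_lim.
  split => //; have -> : K f t = 0; last by rewrite normr0.
  apply: (cvg_unique _ (Glim t Dt)) => //; apply: cvg_near_cst.
  by apply: nearW => p; exact: G0.
have mq g : measurable_fun D (q g) by exact: (qN g).1.1.
have mL : measurable_fun D L.
  by apply: (measurable_fun_cvg mq) => t Dt; exact: (qlim t Dt).1.
have mK : measurable_fun D (K f).
  apply: (@measurable_fun_cvg _ _ _ _ G) => [p|t Dt]; last exact: Glim.
  rewrite /G; under eq_fun do rewrite big_nat.
  apply: (eq_measurable_fun (fun t => \sum_(n <- index_iota 1 p)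
     (if (0 < n)%N then \sum_(i < n) FF f n i t * \1_(E n) t else 0))).
    move=> t _; rewrite -[RHS]big_nat !big_nat.
    by apply: eq_bigr => n /andP[-> _].
  apply: measurable_sum => -[|n] //=.
  apply: measurable_sum => i; apply: measurable_funM; first exact: mFF.
  by apply: measurable_indic; exact: mE.
have main x : in_space D (kothe_dual D N) x -> (kothe_dual D N x <= 1)%E ->
    (\int[m]_(t in D) (`|x t * K f t|)%:E <= C1%:E * N f)%E.
  move=> [mx _] x1; have ff := ri_fin ri fN.
  rewrite -(fineK ff) -EFinM; apply/lee_addgt0Pr => e e0.
  have Nf0 : 0 <= fine (N f) by apply: fine_ge0; exact: (ri_ge0 ri).
  have r00 : 0 < C1 * fine (N f) + e by rewrite ltr_wpDl// mulr_ge0// ltW.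
  have mabs (z : R -> R) : measurable_fun D z -> measurable_fun D (fun t => (`|x t * z t|)%:E).
    move=> mz; apply/measurable_EFinP; apply: measurableT_comp => //.
    exact: measurable_funM.
  apply: (@le_trans _ _ (\int[m]_(t in D) limn_einf (fun g => (`|x t * q g t|)%:E))%E).
    have -> : (\int[m]_(t in D) limn_einf (fun g => (`|x t * q g t|)%:E) =
        \int[m]_(t in D) (`|x t * L t|)%:E)%E.
      apply: eq_integral => t; rewrite inE => Dt.
      suff h : (`|x t * q g t|)%:E @[g --> \oo] --> (`|x t * L t|)%:E.
        exact: (cvg_limn_einf_sup h).1.
      apply: cvg_EFin; first exact: nearW.
      by apply: cvg_norm; apply: cvgM; [exact: cvg_cst|exact: (qlim t Dt).1].
    apply: ge0_le_integral => //.
    - exact: measurable_unit_interval.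
    - exact: mabs.
    - exact: mabs.
    - move=> t Dt; rewrite lee_fin !normrM; apply: ler_wpM2l => //.
      exact: le_trans (qlim t Dt).2 (ler_norm _).
  have := @fatou _ _ _ m D measurable_unit_interval (fun g t => (`|x t * q g t|)%:E)
    (fun g => mabs _ (mq g)) (fun g t Dt => normr_ge0 (x t * q g t)).
  move=> /le_trans; apply.
  rewrite limn_einf_lim; apply: lime_le; first exact: is_cvg_einfs.
    apply: nearW => g.
    apply: (@le_trans _ _ (\int[m]_(t in D) (`|x t * q g t|)%:E)%E).
      by apply: ereal_inf_lbound; exists g => //=.
    apply: (kothe_dual_le (qN g).1) => //; apply: (le_trans (qN g).2).
    by rewrite -(fineK ff) -EFinM lee_fin lerDl ltW.
split; last first.
  by apply: ge_ereal_sup => _ [x [xN x1] <-]; exact: main.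
split => //; apply: (@le_lt_trans _ _ (C1%:E * N f)%E).
  by apply: ge_ereal_sup => _ [x [xN x1] <-]; exact: main.
by rewrite -(fineK (ri_fin ri fN)) -EFinM ltry.
Qed.

End KruglovOperator.

Theorem theorem6 (R : realType)
  (A : nat -> set R)
  (A_meas : forall n, measurable (A n))
  (A_sub : forall n, A n `<=` half_line)
  (A_disj : trivIset [set: nat] A)
  (A_pos : forall n, (0 < lebesgue_measure (A n))%E)
  (A_le1 : forall n, (lebesgue_measure (A n) <= 1)%E)
  (A_to0 : (fun n => lebesgue_measure (A n)) @ \oo --> 0%E)
  (A_sum : (\sum_(0 <= n <oo) lebesgue_measure (A n) = +oo)%E)
  (S : nat -> nat -> set nat)
  (S_disj : trivIset [set il : nat * nat | (0 < il.2)%N]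
              (fun il => S il.1 il.2))
  (S_sum : forall i l : nat, (0 < l)%N ->
     \esum_(n in S i l) lebesgue_measure (A n) = (l%:R^-1)%:E)
  (N : (R -> R) -> \bar R)
  (E_ri : ri_space01 N)
  (T : (R -> R) -> R -> R)
  (T_emb : isomorphic_embedding (U_space N A) (Z_norm N) unit_interval N T)
  (l : nat -> nat)
  (l_pos : forall k, (0 < l k)%N)
  (B_in_U : forall k i, U_space N A \1_(\bigcup_(n in S i (l k)) A n))
  (y : nat * nat -> R -> R)
  (y_def : forall k i, y (k, i) = T \1_(\bigcup_(n in S i (l k)) A n))
  (y_indep : independent y)
  (y_sym : forall k i, symmetrically_distributed (y (k, i)))
  (alpha beta gamma : R)
  (alpha_pos : 0 < alpha) (beta_pos : 0 < beta) (gamma_pos : 0 < gamma)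
  (F : nat -> {fset nat})
  (F_card : forall k,
     gamma * (l k)%:R <= (#|` F k|%fset)%:R /\ (#|` F k| <= l k)%N)
  (y_large : forall k i, i \in F k ->
     ((beta / (l k)%:R)%:E <= prob01 [set t | alpha < `|y (k, i) t|]%R)%E) :
  (forall K, kruglov_operator K ->
     bounded_operator unit_interval N unit_interval
       (kothe_dual unit_interval (kothe_dual unit_interval N)) K) /\
  (exists C : R, 0 < C /\ forall k,
     (fundamental_function N
        (((beta / (2 * (l k)%:R)) `^ (gamma * (l k)%:R))%R)
      <= (C / (l k)%:R)%:E)%E).
Proof.
have [_ _ [c [CT [_ CT0 Tle]]]] := T_emb.
have Tbound f : U_space N A f -> (N (T f) <= CT%:E * Z_norm N f)%E.
  by move=> /Tle/andP[].
split; last first.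
  exact: (fundamental_bound A_meas A_sub A_disj S_disj S_sum E_ri T_emb l_pos B_in_U
    y_def y_indep y_sym alpha_pos beta_pos gamma_pos F_card y_large CT0 Tbound).
have [C1 C10 bnd] := kruglov_sum_bound A_meas A_sub A_disj S_disj S_sum E_ri T_emb
  l_pos B_in_U y_def y_indep y_sym alpha_pos beta_pos gamma_pos F_card y_large CT0 Tbound.
by move=> K; exact: (kruglov_bounded E_ri.1 C10 bnd).
Qed.
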